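(* Let $\Sigma$ be a finite set of primes, $k$ a positive integer, and $a_1,\ldots,a_k,b_1,\ldots,b_k\in\mathbb{Z}$ with $a_i\neq0$, $\gcd(a_i,b_i)=1$, $a_ib_j-a_jb_i\neq0$ ($i<j$), such that $(2k)!\prod_i a_i\prod_{i<j}(a_ib_j-a_jb_i)$ is a $\Sigma$-unit. Assume moreover that every $a_i$ is divisible by every prime of $\Sigma$. Then there exist $\eta,c_1,\varepsilon\in(0,1/2]$, depending only on $k$ and $\#\Sigma$, such that: (a) there is $z_1\ge2$ depending on the $a_i,b_i$ with $\#\Omega_1(x,z)\ge c_1x/(\log z)^k$ whenever $x^\eta\ge z\ge z_1$; and (b) for every set $\mathcal P$ of primes with $\bar\delta(\mathcal P)\le\varepsilon$ there exists $x_0\ge2$, depending on $a_1,\ldots,a_k,b_1,\ldots,b_k$ and on $\mathcal P$, such that for all $x\ge x_0$ at least half of the elements $n$ of $\Omega_1(x,x^\eta)$ satisfy $p\nmid L_1(n)\cdots L_k(n)$ for every $p\in\mathcal P$.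
   Context: An integer is a $\Sigma$-unit if all its prime divisors lie in $\Sigma$; it is $\Sigma$-square-free if it is a product of a $\Sigma$-unit and a square-free integer. $P_\Sigma(z)=\prod_{p<z,\,p\notin\Sigma}p$. $L_i(n)=a_in+b_i$. $\Omega(x,z)=\{n\in\mathbb{Z}:1\le n\le x,\ \gcd(L_1(n)\cdots L_k(n),P_\Sigma(z))=1\}$ and $\Omega_1(x,z)=\{n\in\Omega(x,z): L_1(n),\ldots,L_k(n)\text{ are all }\Sigma\text{-square-free composite numbers}\}$. For a set $\mathcal P$ of primes, its relative upper density is $\bar\delta(\mathcal P)=\limsup_{x\to\infty}\#(\mathcal P\cap[1,x])/\pi(x)$. (In the paper, $\eta$ is the number provided by the preceding sieving theorem, whose conclusion is part (a).) *)

(* Defs.v *)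
From Stdlib Require Import Reals ClassicalDescription.
From Coquelicot Require Import Rbar Lim_seq.
From mathcomp Require Import all_boot all_order all_algebra.

Set Implicit Arguments.
Unset Strict Implicit.
Unset Printing Implicit Defensive.
Import GRing.Theory Num.Theory.

Definition pb (P : Prop) : bool :=
  if excluded_middle_informative P then true else false.

Local Open Scope ring_scope.

Definition sigma_unit (Sigma : seq nat) (m : int) : Prop :=
  forall p : nat, prime p -> (p%:Z %| m)%Z -> p \in Sigma.

Definition squarefree_int (m : int) : Prop :=
  forall p : nat, prime p -> ~ ((p ^ 2)%N%:Z %| m)%Z.

Definition sigma_squarefree (Sigma : seq nat) (m : int) : Prop :=
  exists u s : int, sigma_unit Sigma u /\ squarefree_int s /\ m = u * s.

Definition composite_int (m : int) : Prop :=
  (1 < `|m|)%N /\ ~~ prime `|m|.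

Definition Lform (k : nat) (a b : 'I_k -> int) (i : 'I_k) (n : int) : int :=
  a i * n + b i.

Definition Lprod (k : nat) (a b : 'I_k -> int) (n : int) : int :=
  \prod_(i < k) Lform a b i n.

Definition PSigma (Sigma : seq nat) (z : R) : nat :=
  \prod_(0 <= p < Z.to_nat (up z) | prime p && (p \notin Sigma) && pb (Rlt (INR p) z)) p.

(* floor of x as a natural number (0 if x < 0): n <= x iff n <= nfloor x *)
Definition nfloor (x : R) : nat := Z.to_nat (Int_part x).

Definition in_Omega (Sigma : seq nat) (k : nat) (a b : 'I_k -> int) (z : R) (n : nat) : Prop :=
  coprimez (Lprod a b n%:Z) (PSigma Sigma z)%:Z.

Definition in_Omega1 (Sigma : seq nat) (k : nat) (a b : 'I_k -> int) (z : R) (n : nat) : Prop :=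
  in_Omega Sigma a b z n /\
  forall i : 'I_k, sigma_squarefree Sigma (Lform a b i n%:Z) /\ composite_int (Lform a b i n%:Z).

Definition Omega1 (Sigma : seq nat) (k : nat) (a b : 'I_k -> int) (x z : R) : seq nat :=
  [seq n <- iota 1 (nfloor x) | pb (in_Omega1 Sigma a b z n)].

Definition count_upto (P : pred nat) (n : nat) : nat := count P (iota 1 n).

Definition rel_upper_density (P : pred nat) : Rbar :=
  LimSup_seq (fun n => Rdiv (INR (count_upto P n)) (INR (count_upto prime n))).

(* Main.v *)
(* Brun-Hooley sieve.  The primes below z are cut into blocks [N, N^2), and in the
   j-th block from the top inclusion-exclusion is truncated at 2(b + j) factors.
   Chebyshev's bound keeps the sum of k/p over a block below 2k, so the main terms
   differ from the product of the (1 - k/p) by a factor between 1/2 and 2 once b is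
   large, while the exponents of the block ends form a convergent series, so the
   error is at most a fixed power of z.  Mertens' estimates turn the product into a
   power of 1/log z.

   (a) From the n with all L_i(n) free of primes below z one removes those where
   some |L_i(n)| is small, or divisible by p^2 with p >= z, or free of primes below
   y = x^eta0; the last set, which contains the prime values, is smaller by a factor
   log z / log y <= eta / eta0.

   (b) If p in P divides L_i(n) with n in Omega_1(x, x^eta), compositeness provides a
   second prime factor >= x^eta, so x^eta <= p <= C x^(1 - eta) and the sieve applies
   in the residue class of n mod p.  Summing over p costs the factor
   sum 1/p = O(eps / eta) over P, by a dyadic decomposition. *)
Require Import Defs.
From Stdlib Require Import Reals.
From Coquelicot Require Import Rbar Lim_seq.
From mathcomp Require Import all_boot all_order all_algebra.
From mathcomp Require Import Rstruct ring lra zify.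
Import GRing.Theory Num.Theory Order.TTheory.
Set Implicit Arguments.
Unset Strict Implicit.
Unset Printing Implicit Defensive.
Local Open Scope ring_scope.

(* Without these, arguments of type R are parsed in Stdlib's R_scope. *)
#[local] Bind Scope ring_scope with R.
#[local] Arguments ln _%_R.
#[local] Arguments exp _%_R.
#[local] Arguments Rpower _%_R _%_R.

(** * Logarithms and Chebyshev bounds *)

(** Uniformity in the coefficients dictates the order in which constants are chosen. The sieve
    exponent [e] depends on k alone: for p outside Sigma the unit hypothesis gives p > 2k and
    distinct roots of the k forms modulo p, while a prime of Sigma divides every [a i] and hence no
    value, so the local densities are k/p whatever the coefficients. Sigma is felt only through its
    size, as a factor 2 per missing prime in Mertens' product. From [e] comes the level x^(1/(2e)),
    at which the sieve error has order sqrt x; then eta, so small that the rough values are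
    negligible against the lower bound for the sifted set; then c1; and last eps, which has to beat
    constants made of eta and c1. The size of the coefficients enters through a single bound
    |L_i(n)| < A N and moves only the thresholds z1 and x0. *)

Lemma lnM (x y : R) : 0 < x -> 0 < y -> ln (x * y) = ln x + ln y.
Proof. by move=> /RltP ? /RltP ?; exact: ln_mult. Qed.

Lemma lnXn (x : R) n : 0 < x -> ln (x ^+ n) = n%:R * ln x.
Proof. by move=> /RltP ?; rewrite -RpowE -INRE ln_pow. Qed.

Lemma lnV (x : R) : 0 < x -> ln (x^-1) = - ln x.
Proof. by move=> /RltP ?; exact: ln_Rinv. Qed.

Lemma ln_1E : ln (1 : R) = 0.
Proof. exact: ln_1. Qed.

Lemma ltr_ln (x y : R) : 0 < x -> x < y -> ln x < ln y.
Proof. by move=> /RltP ? /RltP ?; apply/RltP/ln_increasing. Qed.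

Lemma ler_ln (x y : R) : 0 < x -> x <= y -> ln x <= ln y.
Proof. by move=> h; rewrite le_eqVlt => /orP[/eqP-> //|h']; apply/ltW/ltr_ln. Qed.

Lemma ln_gt0 (x : R) : 1 < x -> 0 < ln x.
Proof. by move=> h; rewrite -ln_1E; apply: ltr_ln. Qed.

Lemma ln_ge0 (x : R) : 1 <= x -> 0 <= ln x.
Proof. by move=> h; rewrite -ln_1E; apply: ler_ln. Qed.

Lemma expK_ln (x : R) : 0 < x -> exp (ln x) = x.
Proof. by move=> /RltP; exact: exp_ln. Qed.

Lemma exp_gt0 (x : R) : 0 < exp x.
Proof. by apply/RltP; exact: exp_pos. Qed.

Lemma expD (x y : R) : exp (x + y) = exp x * exp y.
Proof. exact: exp_plus. Qed.

Lemma ler_exp (x y : R) : x <= y -> exp x <= exp y.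
Proof.
rewrite le_eqVlt => /orP[/eqP-> //|/RltP h].
by apply/ltW/RltP/exp_increasing.
Qed.

Lemma expR_ge1D (x : R) : 1 + x <= exp x.
Proof. by apply/RleP; exact: exp_ineq1_le. Qed.

Lemma ln_le_sub1 (x : R) : 0 < x -> ln x <= x - 1.
Proof. by move=> h; rewrite lerBrDl -{2}(expK_ln h) expR_ge1D. Qed.

Lemma ln_prod (I : eqType) (s : seq I) (f : I -> R) :
  (forall i, i \in s -> 0 < f i) -> ln (\prod_(i <- s) f i) = \sum_(i <- s) ln (f i).
Proof.
elim: s => [|i s IH] h; first by rewrite !big_nil ln_1E.
have hi j : j \in s -> 0 < f j by move=> js; apply: h; rewrite inE js orbT.
rewrite !big_cons lnM ?IH //; first by apply: h; rewrite inE eqxx.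
by rewrite big_seq prodr_gt0.
Qed.

Lemma exp_sum (I : Type) (s : seq I) (f : I -> R) :
  exp (\sum_(i <- s) f i) = \prod_(i <- s) exp (f i).
Proof.
elim: s => [|i s IH]; first by rewrite !big_nil; exact: exp_0.
by rewrite !big_cons expD IH.
Qed.

Lemma prod_prime_power_dvdn (s : seq nat) (e : nat -> nat) m :
  uniq s -> all prime s -> (forall p, p \in s -> (p ^ e p %| m)%N) ->
  (\prod_(p <- s) p ^ e p %| m)%N.
Proof.
elim: s => [|p s IH] /=; first by rewrite big_nil dvd1n.
case/andP=> ps us /andP[pp sp] h; rewrite big_cons Gauss_dvd.
  by rewrite h ?inE ?eqxx // IH // => q qs; apply: h; rewrite inE qs orbT.
rewrite coprimeXl // {IH h us}.
elim: s ps sp => [|q s IH]; first by rewrite big_nil coprimen1.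
rewrite inE negb_or => /andP[pq ps] /= /andP[qp sp].
by rewrite big_cons coprimeMr IH // coprimeXr // prime_coprime // dvdn_prime2 // pq.
Qed.

Lemma leq_bin_exp2 n m : ('C(n, m) <= 2 ^ n)%N.
Proof.
elim: n m => [|n IH] [|m]; rewrite ?bin0 ?bin0n ?expn_gt0 //.
by rewrite binS expnS mul2n -addnn leq_add.
Qed.

Lemma prime_dvd_fact p n : prime p -> (p %| n`!)%N -> (p <= n)%N.
Proof.
move=> pp; elim: n => [|n IH]; first by rewrite fact0 dvdn1 => /eqP p1; rewrite p1 in pp.
rewrite factS Euclid_dvdM // => /orP[/dvdn_leq->//|/IH h]; exact: leqW.
Qed.

(** A prime in (n, 2n] divides (2n)! but not n!, so it divides the central binomial coefficient,
    which is at most 4^n. *)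
Lemma prod_primes_le_bin n (B : seq nat) :
  uniq B -> (forall p, p \in B -> prime p && (n < p <= n.*2)%N) ->
  (\prod_(p <- B) p <= 4 ^ n)%N.
Proof.
move=> uB hB; apply: (@leq_trans 'C(n.*2, n)); last first.
  by rewrite -[4%N]/(2 ^ 2)%N -expnM mul2n leq_bin_exp2.
apply: dvdn_leq; first by rewrite bin_gt0 -addnn leq_addr.
rewrite (eq_bigr (fun p => p ^ 1)%N); last by move=> p _; rewrite expn1.
apply: prod_prime_power_dvdn => //; first by apply/allP => p /hB /andP[].
move=> p /hB /and3P[pp np p2n]; rewrite expn1.
have : (p %| n.*2`!)%N by rewrite dvdn_fact // prime_gt0.
rewrite -(@bin_fact n.*2 n) -?addnn ?leq_addr // addnK Euclid_dvdM // => /orP[//|].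
by rewrite Euclid_dvdM // orbb => /(prime_dvd_fact pp); rewrite leqNgt np.
Qed.

Lemma prod_primes_le n : (\prod_(p <- iota 0 n.+1 | prime p) p <= 16 ^ n)%N.
Proof.
elim/ltn_ind: n => n IH.
(* Halving: the primes in (h, n] contribute at most 4^h, and 16^h 4^h <= 16^n amounts to 3h <= 2n,
   which holds from n = 3 on. *)
case: (ltnP n 3) => [|n3].
  by case: n {IH} => [|[|[|]]] // _; rewrite !big_cons big_nil.
set h := uphalf n.
have hn : (h < n)%N by rewrite /h; lia.
have -> : n.+1 = (h.+1 + (n - h))%N by rewrite /h; lia.
rewrite iotaD big_cat [(0 + _)%N]add0n.
apply: (@leq_trans (16 ^ h * 4 ^ h)).
  apply: leq_mul; first exact: IH.
  rewrite -big_filter; apply: prod_primes_le_bin; first by rewrite filter_uniq ?iota_uniq.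
  move=> p; rewrite mem_filter mem_iota => /and3P[-> h1 h2] /=; rewrite /h in h1 h2 *; lia.
rewrite -[16%N]/(4 ^ 2)%N -!expnM -expnD.
by rewrite leq_exp2l // /h; lia.
Qed.

(** * Mertens' estimates *)

Lemma ler_sum_subset (T : eqType) (s t : seq T) (f : T -> R) :
  uniq s -> {subset s <= t} -> (forall x, 0 <= f x) ->
  \sum_(x <- s) f x <= \sum_(x <- t) f x.
Proof.
elim: s t => [|x s IH] t /=; first by rewrite big_nil => _ _ f0; apply: sumr_ge0.
case/andP=> xs us st f0.
have xt : x \in t by apply: st; rewrite inE eqxx.
rewrite big_cons (perm_big _ (perm_to_rem xt)) big_cons lerD2l; apply: IH => // y ys.
have := st y; rewrite inE ys orbT (perm_mem (perm_to_rem xt)) inE => /(_ isT) /predU1P[yx|//].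
by rewrite -yx ys in xs.
Qed.

Lemma leq_fact_exp n : (n`! <= n ^ n)%N.
Proof.
elim: n => // n IH; rewrite factS expnS leq_mul2l /=.
by apply: leq_trans IH _; case: n => // n; rewrite leq_exp2r.
Qed.

(** By the first term of Legendre's formula the product of the p^(n %/ p) divides n!, which is at
    most n^n. Replacing the floor by n/p costs the sum of the ln p, at most n ln 16 by Chebyshev. *)
Lemma mertens_first n : (0 < n)%N ->
  \sum_(0 <= p < n.+1 | prime p) ln p%:R / p%:R <= ln n%:R + ln 16%:R :> R.
Proof.
move=> n0; have n0' : 0 < n%:R :> R by rewrite ltr0n.
have lt16 : 0 < 16%:R :> R by rewrite ltr0n.
rewrite -big_filter; set s := [seq _ <- _ | _].
have sp p : p \in s -> prime p by rewrite mem_filter => /andP[].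
have us : uniq s by rewrite filter_uniq ?iota_uniq.
have sp0 p : p \in s -> 0 < p%:R :> R by move=> /sp/prime_gt0; rewrite ltr0n.
have H1 : \sum_(p <- s) (n %/ p)%:R * ln p%:R <= n%:R * ln n%:R :> R.
  have E : (\prod_(p <- s) p ^ (n %/ p) <= n ^ n)%N.
    apply: leq_trans (leq_fact_exp n).
    apply: dvdn_leq; first exact: fact_gt0.
    apply: prod_prime_power_dvdn => //; first by apply/allP.
    move=> p ps; rewrite pfactor_dvdn ?fact_gt0 ?sp // logn_fact ?sp //.
    by rewrite big_ltn // expn1 leq_addr.
  rewrite -lnXn // -natrX; apply: le_trans (ler_ln _ (_ : (\prod_(p <- s) p ^ (n %/ p))%N%:R <= _)).
  - rewrite natr_prod ln_prod => [|p ps]; last by rewrite natrX exprn_gt0 ?sp0.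
    rewrite big_seq [X in _ <= X]big_seq; apply: ler_sum => p ps.
    by rewrite natrX lnXn ?sp0.
  - by rewrite natr_prod big_seq prodr_gt0 // => p ps; rewrite natrX exprn_gt0 ?sp0.
  - by rewrite ler_nat.
have H2 : \sum_(p <- s) ln p%:R <= n%:R * ln 16%:R :> R.
  rewrite -ln_prod // -lnXn // ler_ln //; first by rewrite big_seq prodr_gt0.
  by rewrite -natr_prod -natrX ler_nat big_filter; exact: prod_primes_le.
rewrite -(ler_pM2l n0') mulrDr -lerBlDr; apply: le_trans H1; rewrite lerBlDr.
apply: le_trans (lerD (lexx _) H2); rewrite -big_split /= mulr_sumr.
rewrite big_seq [X in _ <= X]big_seq; apply: ler_sum => p ps.
have p0 := sp0 _ ps.
have l0 : 0 <= ln p%:R :> R by rewrite ln_ge0 // ler1n prime_gt0 ?sp.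
rewrite mulrCA -[X in _ + X]mul1r -mulrDl mulrC ler_wpM2r //.
rewrite ler_pdivrMr // natr1 -natrM ler_nat ltnW // ltn_ceil //.
by rewrite prime_gt0 ?sp.
Qed.

(* Abel summation of [mertens_first] against 1/ln, as a monotone induction. *)
Lemma mertens_second : exists C : R, forall n, (2 <= n)%N ->
  \sum_(0 <= p < n.+1 | prime p) p%:R^-1 <= ln (ln n%:R) + C.
Proof.
pose A n : R := \sum_(0 <= p < n.+1 | prime p) ln p%:R / p%:R.
pose S n : R := \sum_(0 <= p < n.+1 | prime p) p%:R^-1.
pose D n : R := ln n%:R + ln 16%:R - A n.
have D0 n : (0 < n)%N -> 0 <= D n by move=> n0; rewrite subr_ge0 mertens_first.
exists (S 2%N + D 2%N / ln 2%:R - ln (ln 2%:R)) => n; rewrite -/(S n).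
set C := _ - _ => n2.
have lp m : (2 <= m)%N -> 0 < ln m%:R :> R by move=> m2; rewrite ln_gt0 // ltr1n.
(* [D] is the nonnegative slack in [mertens_first]. With [D n / ln n] added, the difference to ln ln
   n is nonincreasing: a new prime p raises [S] by 1/p and lowers the added term by the same
   amount. *)
suff : S n + D n / ln n%:R <= ln (ln n%:R) + C.
  apply: le_trans; rewrite lerDl divr_ge0 ?D0 //; first exact: leq_trans n2.
  exact/ltW/lp.
elim: n n2 => // n IH; rewrite leq_eqVlt => /orP[/eqP<-|n2]; first by rewrite /C; lra.
rewrite ltnS in n2; have {IH} := IH n2.
have hS : S n.+1 = S n + (if prime n.+1 then n.+1%:R^-1 else 0).
  by rewrite /S big_mkcond big_nat_recr //= -big_mkcond.
have hA : A n.+1 = A n + ln n.+1%:R * (if prime n.+1 then n.+1%:R^-1 else 0).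
  rewrite /A big_mkcond big_nat_recr //= -big_mkcond; case: ifP => //.
  by rewrite mulr0.
have l0 := lp n n2; have l1 := lp n.+1 (leqW n2).
have ll : ln n%:R <= ln n.+1%:R :> R.
  by rewrite ler_ln ?ltr0n ?ler_nat //; apply: ltn_trans n2.
move: hS hA; set t := if _ then _ else _ => hS hA.
have hD : D n.+1 = D n + (ln n.+1%:R - ln n%:R) - ln n.+1%:R * t by rewrite /D hA; ring.
have := D0 n (ltnW n2); rewrite hS hD.
have h1 : 1 - ln n%:R / ln n.+1%:R <= ln (ln n.+1%:R) - ln (ln n%:R) :> R.
  have := @ln_le_sub1 (ln n%:R / ln n.+1%:R) (divr_gt0 l0 l1).
  by rewrite lnM ?invr_gt0 // lnV // -[_ - 1]opprB -[_ - ln _]opprB lerN2.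
move: l0 l1 ll h1; set u := ln n%:R; set v := ln n.+1%:R => l0 l1 ll h1 d0 h.
have -> : (D n + (v - u) - v * t) / v = D n / v + (1 - u / v) - t.
  by field; rewrite gt_eqF.
have : D n / v <= D n / u by rewrite ler_wpM2l // lef_pV2 ?posrE.
lra.
Qed.

Lemma harmonic_ge_ln n : (0 < n)%N -> ln n%:R <= \sum_(1 <= m < n) m%:R^-1 :> R.
Proof.
elim: n => // -[|n] IH _; first by rewrite big_geq // ln_1E.
rewrite big_nat_recr //= -lerBlDl; apply: le_trans (lerB (lexx _) (IH isT)) _.
have n0 : 0 < n.+1%:R :> R by rewrite ltr0n.
have n1 : 0 < n.+2%:R :> R by rewrite ltr0n.
have := @ln_le_sub1 (n.+2%:R / n.+1%:R) (divr_gt0 n1 n0).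
rewrite lnM ?invr_gt0 // lnV // => h; apply: le_trans h _.
by rewrite -[n.+2%:R]natr1 mulrDl divff ?gt_eqF // mul1r addrAC subrr add0r.
Qed.

(** A truncated Euler product: for primes [ps] it increases with N to the product of the (1 -
    1/p)^-1. The truncation keeps all sums finite. *)
Definition smooth_sum (ps : seq nat) (N : nat) : R :=
  \sum_(m <- iota 1 N | all (mem ps) (primes m)) m%:R^-1.

(** Removal of one Euler factor: the multiples of p in the sum, divided by p, are distinct terms of
    the same sum, so they carry at most 1/p of it; the other terms are free of p. *)
Lemma smooth_sum_cons p ps N : prime p ->
  smooth_sum (p :: ps) N * (1 - p%:R^-1) <= smooth_sum ps N.
Proof.
move=> pp; have p0 : 0 < p%:R :> R by rewrite ltr0n prime_gt0.
rewrite mulrBr mulr1 lerBlDr /smooth_sum [X in X <= _](bigID (fun m => p %| m)%N) /= addrC.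
have inv0 m : 0 <= m%:R^-1 :> R by rewrite invr_ge0 ler0n.
apply: lerD.
  rewrite -big_filter -[X in _ <= X]big_filter; apply: ler_sum_subset => //.
    by rewrite filter_uniq ?iota_uniq.
  move=> m; rewrite !mem_filter => /andP[/andP[/allP h pm] ->]; rewrite andbT.
  apply/allP => q qm; have := h q qm; rewrite /= inE => /predU1P[qp|//].
  by rewrite qp mem_primes (negPf pm) !andbF in qm.
rewrite mulr_suml -big_filter -[X in _ <= X]big_filter.
set s := [seq _ <- _ | _].
have sP m : m \in s -> [/\ (p %| m)%N, (0 < m)%N & (m <= N)%N].
  by rewrite mem_filter mem_iota => /andP[/andP[_ ->]] /andP[-> h]; rewrite -ltnS.
rewrite (eq_big_seq (fun m => (m %/ p)%:R^-1 / p%:R)); last first.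
  by move=> m /sP[pm _ _]; rewrite -invfM -natrM divnK.
rewrite -(big_map (fun m => m %/ p)%N predT (fun m : nat => m%:R^-1 / p%:R)).
apply: ler_sum_subset; last by move=> m; rewrite divr_ge0 ?ler0n.
  rewrite map_inj_in_uniq ?filter_uniq ?iota_uniq // => x y /sP[px _ _] /sP[py _ _] e.
  by rewrite -(divnK px) -(divnK py) e.
move=> m' /mapP[m ms ->]; have [pm m0 mN] := sP _ ms.
move: ms; rewrite !mem_filter !mem_iota => /andP[/andP[/allP h _] _].
have q0 : (0 < m %/ p)%N by rewrite divn_gt0 ?prime_gt0 // dvdn_leq.
rewrite q0 add1n ltnS (leq_trans (leq_div _ _) mN) !andbT.
apply/allP => q; rewrite mem_primes => /and3P[qp _ qm]; apply: h.
by rewrite mem_primes qp m0 (dvdn_trans qm) // -{2}(divnK pm) dvdn_mulr.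
Qed.

(** Every m < n has all its prime factors below n, so the truncated Euler product is at least the
    harmonic sum; stripping its factors one by one leaves at most 1. *)
Lemma mertens_third n : (0 < n)%N ->
  \prod_(0 <= p < n | prime p) (1 - p%:R^-1) * ln n%:R <= 1 :> R.
Proof.
move=> n0; rewrite -big_filter; set s := [seq _ <- _ | _].
have sp : all prime s by apply/allP => p; rewrite mem_filter => /andP[].
have inv1 p : prime p -> 0 <= 1 - p%:R^-1 :> R.
  move=> pp; rewrite subr_ge0 invf_le1 ?ler1n ?ltr0n prime_gt0 //.
have H t N : all prime t -> smooth_sum t N * \prod_(p <- t) (1 - p%:R^-1) <= 1.
  elim: t => [_|p t IH /= /andP[pp tp]].
    rewrite big_nil mulr1 /smooth_sum; case: N => [|N]; first by rewrite big_nil.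
    rewrite /= big_cons /= invr1 big_seq_cond big_pred0 ?addr0 // => m.
    apply/negP => /andP[]; rewrite mem_iota => /andP[m2 _] /allP h.
    have /h // : pdiv m \in primes m.
    by rewrite mem_primes pdiv_prime // pdiv_dvd (ltnW m2).
  rewrite big_cons mulrA; apply: le_trans (IH tp); apply: ler_wpM2r.
    by rewrite big_seq prodr_ge0 // => q qt; rewrite inv1 //; exact: (allP tp).
  exact: smooth_sum_cons.
apply: le_trans (H s n.-1 sp); rewrite mulrC ler_wpM2r //.
  by rewrite big_seq prodr_ge0 // => q qt; rewrite inv1 //; exact: (allP sp).
apply: le_trans (harmonic_ge_ln n0) _; rewrite /smooth_sum /index_iota subn1 -[X in _ <= X]big_filter.
rewrite (_ : [seq _ <- _ | _] = iota 1 n.-1) //; apply/all_filterP/allP => m.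
rewrite mem_iota => /andP[m0 mn]; apply/allP => p; rewrite mem_primes => /and3P[pp _ pm].
rewrite /= mem_filter; apply/andP; split; first exact: pp.
rewrite mem_iota /= add0n subn0.
by apply: leq_ltn_trans (dvdn_leq m0 pm) _; move: mn; rewrite add1n prednK.
Qed.

Lemma dyadic_count m (B : seq nat) : uniq B ->
  (forall p, p \in B -> prime p && (2 ^ m <= p < 2 ^ m.+1)%N) ->
  (m * size B <= 2 ^ m.+1)%N.
Proof.
case: m => [|[|m]] uB hB //.
  have : (size B <= size [:: 2; 3])%N.
    apply: uniq_leq_size => // p /hB /and3P[_]; rewrite !inE -[(2 ^ 1)%N]/2%N -[(2 ^ 2)%N]/4%N; lia.
  by rewrite mul1n => /leq_trans->.
rewrite -(@leq_exp2l 2) // expnM.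
apply: (@leq_trans (\prod_(p <- B) p)%N).
  elim: B hB {uB} => [|p B IH] hB; first by rewrite big_nil.
  rewrite big_cons [size _]/= [X in (X <= _)%N]expnS; apply: leq_mul; first by have /and3P[_ ->] := hB p (mem_head _ _).
  by apply: IH => q qB; apply: hB; rewrite inE qB orbT.
rewrite [in X in (_ <= X)%N]expnS expnM; apply: prod_primes_le_bin => // p /hB /and3P[pp h1 h2].
rewrite pp /= -mul2n -expnS (ltnW h2) andbT ltn_neqAle h1 andbT.
(* The left end of the block is a power of 2 that is at least 4, hence not a prime, so the block
   falls in the range of [prod_primes_le_bin]. The block of 2 and 3 was counted by hand. *)
apply: contraTneq pp => <-; apply/primePn; right; exists 2; last by rewrite expnS dvdn_mulr.
by rewrite /= -[X in (X < _)%N]expn1 ltn_exp2l.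
Qed.

Lemma dyadic_recip m (B : seq nat) : (0 < m)%N -> uniq B ->
  (forall p, p \in B -> prime p && (2 ^ m <= p < 2 ^ m.+1)%N) ->
  \sum_(p <- B) p%:R^-1 <= 2 / m%:R :> R.
Proof.
move=> m0 uB hB; have h2 : 0 < (2 ^ m)%:R :> R by rewrite ltr0n expn_gt0.
apply: (@le_trans _ _ (\sum_(p <- B) (2 ^ m)%:R^-1)).
  rewrite big_seq [X in _ <= X]big_seq; apply: ler_sum => p /hB /and3P[_ pm _].
  by rewrite lef_pV2 ?posrE ?ltr0n ?(leq_trans _ pm) ?expn_gt0 // ler_nat.
rewrite big_const_seq count_predT iter_addr addr0 -[X in X <= _]mulr_natl ler_pdivrMr // mulrAC.
rewrite ler_pdivlMr ?ltr0n // -!natrM ler_nat mulnC -expnS.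
exact: dyadic_count.
Qed.

(** The block consists of m dyadic pieces, each contributing at most 2/m. The bound is free of m,
    which is what makes blocks [N, N^2) suitable for the sieve. *)
Lemma block_recip m (B : seq nat) : (0 < m)%N -> uniq B ->
  (forall p, p \in B -> prime p && (2 ^ m <= p < 2 ^ m.*2)%N) ->
  \sum_(p <- B) p%:R^-1 <= 2 :> R.
Proof.
move=> m0 uB hB; have m0' : 0 < m%:R :> R by rewrite ltr0n.
have H l C : uniq C -> (forall p, p \in C -> prime p && (2 ^ m <= p < 2 ^ (m + l))%N) ->
    \sum_(p <- C) p%:R^-1 <= l%:R * (2 / m%:R) :> R.
  elim: l C => [|l IH] C uC hC.
    rewrite mul0r; case: C hC {uC} => [|p C] hC; first by rewrite big_nil.
    by have := hC p (mem_head _ _); rewrite addn0 ltnNge; case: leqP; rewrite ?andbF.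
  rewrite (bigID (fun p => p < 2 ^ (m + l))%N) /= -natr1 mulrDl mul1r -big_filter.
  rewrite -[X in _ + X]big_filter; apply: lerD.
    apply: IH; first by rewrite filter_uniq.
    by move=> p; rewrite mem_filter => /andP[h1 /hC /and3P[-> -> _]].
  apply: (@le_trans _ _ (2 / (m + l)%:R)).
    apply: dyadic_recip; rewrite ?addn_gt0 ?m0 ?filter_uniq //.
    move=> p; rewrite mem_filter -leqNgt => /andP[h1 /hC /and3P[-> _]].
    by rewrite addnS h1.
  by rewrite ler_wpM2l // lef_pV2 ?posrE ?ltr0n ?addn_gt0 ?m0 // ler_nat leq_addr.
have := H m B uB; rewrite mulrC divfK ?gt_eqF // addnn; exact.
Qed.

Lemma prime_count_dyadic m : (m * count prime (iota 1 (2 ^ m)) <= 4 * 2 ^ m)%N.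
Proof.
(* With Q = 2^m, the induction hypothesis and the new dyadic piece bound m times the new count by 4Q
   + 2Q, and 6(m + 1) <= 8m from m = 3 on. *)
elim: m => // m IH; case: (ltnP m 3) => [|m3].
  by case: m {IH} => [|[|[|]]].
have -> : (2 ^ m.+1 = 2 ^ m + 2 ^ m)%N by rewrite expnS mul2n addnn.
rewrite iotaD count_cat add1n.
set B := [seq p <- iota (2 ^ m).+1 (2 ^ m) | prime p].
have : (m * size B <= 2 ^ m.+1)%N.
  apply: dyadic_count; first by rewrite filter_uniq ?iota_uniq.
  move=> p; rewrite mem_filter mem_iota => /and3P[pp h1 h2].
  rewrite pp (ltnW h1) /= ltn_neqAle -ltnS expnS mul2n -addnn h2 andbT.
  apply: contraTneq pp => ->; apply/primePn; right; exists 2; last first.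
    by case: m m3 {IH B h1 h2} => // m _; rewrite addnn -mul2n dvdn_mulr.
  rewrite /= addnn -mul2n -expnS -[X in (X < _)%N]expn1 ltn_exp2l //; lia.
rewrite expnS size_filter -/B; move: IH; set c1 := count _ _; set c2 := count _ _.
move: (2 ^ m)%N => Q h1 h2.
rewrite -(@leq_pmul2l m); last by lia.
have -> : (m * (m.+1 * (c1 + c2)) = m.+1 * (m * c1 + m * c2))%N by ring.
have : (m.+1 * (m * c1 + m * c2) <= m.+1 * (6 * Q))%N by rewrite leq_mul2l; lia.
move=> /leq_trans; apply; nia.
Qed.

(** * Brun-Hooley weights *)

(* A multilinear polynomial in variables indexed by the primes, as a list of terms
   (coefficient, monomial).  Evaluating the same polynomial at the indicators of
   p | n, at the densities kappa(p)/p and at kappa(p) gives a sieve weight, its main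
   term and a bound for its error term. *)
Definition sieve_poly := seq (R * seq nat).

Definition evalp (h : nat -> R) (W : sieve_poly) : R :=
  \sum_(w <- W) w.1 * \prod_(p <- w.2) h p.

Definition absp (W : sieve_poly) : sieve_poly := [seq (`|w.1|, w.2) | w <- W].

Definition oppp (W : sieve_poly) : sieve_poly := [seq (- w.1, w.2) | w <- W].

Definition mulp (W1 W2 : sieve_poly) : sieve_poly :=
  [seq (w1.1 * w2.1, w1.2 ++ w2.2) | w1 <- W1, w2 <- W2].

Definition mulXp (p : nat) (W : sieve_poly) : sieve_poly :=
  [seq (w.1, p :: w.2) | w <- W].

Definition onep : sieve_poly := [:: (1, [::])].

Arguments absp : simpl never.
Arguments oppp : simpl never.
Arguments mulp : simpl never.
Arguments mulXp : simpl never.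

Lemma evalp_one h : evalp h onep = 1.
Proof. by rewrite /evalp big_seq1 big_nil mulr1. Qed.

Lemma evalp_cat h W1 W2 : evalp h (W1 ++ W2) = evalp h W1 + evalp h W2.
Proof. by rewrite /evalp big_cat. Qed.

Lemma evalp_opp h W : evalp h (oppp W) = - evalp h W.
Proof.
by rewrite /evalp big_map /= -sumrN; apply: eq_bigr => w _; rewrite mulNr.
Qed.

Lemma evalp_mulX h p W : evalp h (mulXp p W) = h p * evalp h W.
Proof.
rewrite /evalp big_map /= mulr_sumr; apply: eq_bigr => w _.
by rewrite big_cons mulrCA.
Qed.

Lemma evalp_mul h W1 W2 : evalp h (mulp W1 W2) = evalp h W1 * evalp h W2.
Proof.
elim: W1 => [|w1 W1 IH]; first by rewrite /evalp !big_nil mul0r.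
rewrite /mulp allpairs_cons evalp_cat -/(mulp _ _) IH.
rewrite [evalp h (w1 :: W1)]/evalp big_cons mulrDl; congr (_ + _).
rewrite /evalp big_map mulr_sumr; apply: eq_bigr => w2 _.
by rewrite big_cat /= mulrACA.
Qed.

Lemma absp_cat W1 W2 : absp (W1 ++ W2) = absp W1 ++ absp W2.
Proof. exact: map_cat. Qed.

Lemma absp_opp W : absp (oppp W) = absp W.
Proof. by rewrite /absp /oppp -map_comp; apply: eq_map => w /=; rewrite normrN. Qed.

Lemma absp_mulX p W : absp (mulXp p W) = mulXp p (absp W).
Proof. by rewrite /absp /mulXp -!map_comp. Qed.

Lemma absp_mul W1 W2 : absp (mulp W1 W2) = mulp (absp W1) (absp W2).
Proof.
rewrite /absp /mulp map_allpairs allpairs_mapl allpairs_mapr.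
by apply: eq_allpairs => w1 w2 /=; rewrite normrM.
Qed.

Definition suppp (B : seq nat) (W : sieve_poly) := all (fun w => subseq w.2 B) W.

Lemma suppp_cat B W1 W2 : suppp B (W1 ++ W2) = suppp B W1 && suppp B W2.
Proof. exact: all_cat. Qed.

Lemma suppp_opp B W : suppp B (oppp W) = suppp B W.
Proof. by rewrite /suppp all_map. Qed.

Lemma suppp_mulX B p W : suppp B W -> suppp (p :: B) (mulXp p W).
Proof.
by move=> /allP h; rewrite /suppp all_map; apply/allP => w /h /=; rewrite eqxx.
Qed.

Lemma suppp_cons B p W : suppp B W -> suppp (p :: B) W.
Proof.
move=> /allP h; apply/allP => w /h /= hs.
exact: subseq_trans hs (subseq_cons _ _).
Qed.

Lemma suppp_mul B1 B2 W1 W2 :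
  suppp B1 W1 -> suppp B2 W2 -> suppp (B1 ++ B2) (mulp W1 W2).
Proof.
move=> /allP h1 /allP h2; apply/allP => w /allpairsP [[w1 w2] /= [i1 i2 ->]] /=.
by apply: cat_subseq; [apply: h1|apply: h2].
Qed.

(* [elemp B m] is the m-th elementary symmetric polynomial in the variables
   of B, and [truncp B M] the alternating sum of those of index at most M. *)
Fixpoint elemp (B : seq nat) (m : nat) : sieve_poly :=
  match B, m with
  | _, 0 => onep
  | [::], _.+1 => [::]
  | p :: B', m'.+1 => elemp B' m ++ mulXp p (elemp B' m')
  end.

Fixpoint truncp (B : seq nat) (M : nat) : sieve_poly :=
  match B, M with
  | p :: B', M'.+1 => truncp B' M ++ oppp (mulXp p (truncp B' M'))
  | _, _ => onep
  end.

Lemma suppp_elem B m : suppp B (elemp B m).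
Proof.
elim: B m => [|p B IH] [|m] //=.
by rewrite suppp_cat suppp_cons // suppp_mulX.
Qed.

Lemma suppp_trunc B m : suppp B (truncp B m).
Proof.
elim: B m => [|p B IH] [|m] //=.
by rewrite suppp_cat suppp_cons // suppp_opp suppp_mulX.
Qed.

Lemma absp_one : absp onep = onep.
Proof. by rewrite /absp /= normr1. Qed.

Lemma absp_elem B m : absp (elemp B m) = elemp B m.
Proof.
elim: B m => [|p B IH] [|m]; [exact: absp_one | by [] | exact: absp_one |].
by rewrite [elemp _ _]/= absp_cat absp_mulX !IH.
Qed.

Section Bounds.
Variable h : nat -> R.

Lemma evalp_elem_ge0 B m : (forall p, 0 <= h p) -> 0 <= evalp h (elemp B m).
Proof.
move=> h0; elim: B m => [|p B IH] [|m] /=; rewrite ?evalp_one ?ler01 //.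
  by rewrite /evalp big_nil.
by rewrite evalp_cat evalp_mulX addr_ge0 // mulr_ge0.
Qed.

Lemma sieve_prod_ge0 B : (forall p, 0 <= h p <= 1) -> 0 <= \prod_(p <- B) (1 - h p).
Proof. by move=> h0; apply: prodr_ge0 => p _; rewrite subr_ge0; case/andP: (h0 p). Qed.

Lemma sieve_prod_le1 B : (forall p, 0 <= h p <= 1) -> \prod_(p <- B) (1 - h p) <= 1.
Proof.
move=> h0; elim: B => [|p B IH]; rewrite ?big_nil // big_cons.
have /andP[? ?] := h0 p.
by apply: mulr_ile1 => //; rewrite ?sieve_prod_ge0 //; lra.
Qed.

(* Bonferroni's inequalities, for weights in [0, 1] rather than indicators *)
Lemma bonferroni B M : (forall p, 0 <= h p <= 1) ->
  0 <= (-1) ^+ M * (evalp h (truncp B M) - \prod_(p <- B) (1 - h p))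
    <= evalp h (elemp B M.+1).
Proof.
move=> h0; have h0' p : 0 <= h p by case/andP: (h0 p).
elim: B M => [|p B IH] M.
  by case: M => [|M] /=; rewrite evalp_one big_nil subrr mulr0 /evalp big_nil lexx.
have /andP[hp0 hp1] := h0 p; rewrite big_cons.
case: M => [|M].
  have /andP[] := IH 0%N.
  have -> : truncp B 0 = onep by case: B {IH}.
  rewrite /= !evalp_one evalp_cat evalp_mulX !expr0 !mul1r.
  have -> : elemp B 0 = onep by case: B {IH}.
  rewrite evalp_one => h1 h2.
  have := sieve_prod_ge0 B h0; have := sieve_prod_le1 B h0.
  set V := \prod_(_ <- _) _ in h1 h2 *; set E := evalp _ _ in h1 h2 * => *.
  by apply/andP; split; nra.
have /andP[a1 a2] := IH M.+1; have /andP[b1 b2] := IH M.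
rewrite /= !evalp_cat evalp_opp !evalp_mulX -/(elemp (_ :: _) _).
move: a1 a2 b1 b2.
set T1 := evalp _ (truncp B M.+1); set T := evalp _ (truncp B M).
set V := \prod_(_ <- _) _ => a1 a2 b1 b2.
(* The minus sign in front of the monomials containing p cancels against the change of parity from
   M.+1 to M, so the induction hypotheses make both summands nonnegative. *)
have -> : (-1) ^+ M.+1 * (T1 - h p * T - (1 - h p) * V)
   = (-1) ^+ M.+1 * (T1 - V) + h p * ((-1) ^+ M * (T - V)) by rewrite exprS; ring.
apply/andP; split; first by rewrite addr_ge0 // mulr_ge0.
by apply: lerD => //; apply: ler_wpM2l.
Qed.

Lemma trunc_even_bounds B b : (forall p, 0 <= h p <= 1) ->
  \prod_(p <- B) (1 - h p) <= evalp h (truncp B b.*2)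
    <= \prod_(p <- B) (1 - h p) + evalp h (elemp B b.*2.+1).
Proof.
move=> h0; have := bonferroni B b.*2 h0.
by rewrite -signr_odd odd_double expr0 mul1r subr_ge0 lerBlDl.
Qed.

(** In the expansion of the m-th power every product over m distinct positions occurs m! times. For
    the induction the first two terms of the binomial formula, [key], are enough. *)
Lemma elem_le_pow B m : (forall p, 0 <= h p) ->
  evalp h (elemp B m) * (m`!)%:R <= (\sum_(p <- B) h p) ^+ m.
Proof.
move=> h0; elim: B m => [|p B IH] [|m] /=; rewrite ?evalp_one ?mul1r ?expr0 //.
  by rewrite /evalp !big_nil mul0r expr0n.
rewrite evalp_cat evalp_mulX big_cons factS natrM.
have H1 := IH m.+1; have H2 := IH m; rewrite factS natrM in H1.
have S0 : 0 <= \sum_(q <- B) h q by apply: sumr_ge0.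
set S := \sum_(q <- B) h q in H1 H2 S0 *.
have key : forall n, S ^+ n.+1 + n.+1%:R * h p * S ^+ n <= (h p + S) ^+ n.+1.
  elim=> [|n IHn]; first by rewrite !expr1 expr0 !mulr1 addrC mul1r.
  rewrite [X in _ <= X]exprS.
  have h1 : 0 <= h p + S by rewrite addr_ge0.
  apply: le_trans (ler_wpM2l h1 IHn).
  have : 0 <= h p * n.+1%:R * h p * S ^+ n by rewrite !mulr_ge0 ?exprn_ge0.
  rewrite -[n.+2%:R]natr1 !exprS; lra.
apply: le_trans (key m).
have hp := h0 p.
have : h p * evalp h (elemp B m) * (m.+1%:R * (m`!)%:R) <= m.+1%:R * h p * S ^+ m.
  by rewrite mulrACA (mulrC (h p)) [X in X <= _]mulrA -mulrA ler_wpM2l // mulr_ge0.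
by move=> H3; rewrite mulrDl lerD.
Qed.

(** The next elementary symmetric polynomial is carried along because a block of the lower weight
    uses both; bounding their sum makes the error of the lower weight a plain product over the
    blocks, as for the upper one. *)
Lemma abs_trunc_le B M : (forall p, 0 <= h p) ->
  evalp h (absp (truncp B M)) + evalp h (elemp B M.+1) <= (1 + \sum_(p <- B) h p) ^+ M.+1.
Proof.
move=> h0; elim: B M => [|p B IH] [|M] /=.
- by rewrite absp_one evalp_one /evalp !big_nil.
- by rewrite absp_one evalp_one /evalp !big_nil !addr0 expr1n.
- have := IH 0%N.
  have -> : truncp B 0 = onep by case: B {IH}.
  have -> : elemp B 0 = onep by case: B {IH}.
  rewrite absp_one evalp_one !expr1 evalp_cat evalp_mulX evalp_one big_cons; lra.
rewrite absp_cat absp_opp absp_mulX !evalp_cat !evalp_mulX big_cons -/(elemp (_ :: _) _).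
have H1 := IH M.+1; have H2 := ler_wpM2l (h0 p) (IH M).
have S0 : 0 <= \sum_(q <- B) h q by apply: sumr_ge0.
set S := \sum_(q <- B) h q in H1 H2 S0 *.
have H3 : (1 + S) ^+ M.+1 <= (1 + (h p + S)) ^+ M.+1.
  by rewrite lerXn2r ?nnegrE ?addr_ge0 // lerD2l lerDr.
have H4 : (1 + (h p + S)) * (1 + S) ^+ M.+1 <= (1 + (h p + S)) ^+ M.+2.
  by rewrite [X in _ <= X]exprS ler_wpM2l // !addr_ge0.
apply: le_trans H4; rewrite [X in _ <= X]exprS in H1.
by set Q := (1 + S) ^+ M.+1 in H1 H2 H3 *; lra.
Qed.
End Bounds.

(* Brun-Hooley weights: the primes are split into blocks, and a block B paired
   with b is sieved by inclusion-exclusion truncated at 2b. *)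
Fixpoint upperp (bl : seq (seq nat * nat)) : sieve_poly :=
  if bl is (B, b) :: bl' then mulp (truncp B b.*2) (upperp bl') else onep.

(** Odd truncations may be negative and cannot be multiplied into a lower bound. Hooley's
    substitute: if V <= T <= V + E in the first block and L <= W <= U in the rest, then V W >= T W -
    E W >= T L - E U. *)
Fixpoint lowerp (bl : seq (seq nat * nat)) : sieve_poly :=
  if bl is (B, b) :: bl' then
    mulp (truncp B b.*2) (lowerp bl') ++ oppp (mulp (elemp B b.*2.+1) (upperp bl'))
  else onep.

Definition block_union (bl : seq (seq nat * nat)) := flatten (unzip1 bl).

Lemma suppp_upper bl : suppp (block_union bl) (upperp bl).
Proof. by elim: bl => [|[B b] bl IH] //=; rewrite suppp_mul // suppp_trunc. Qed.

Lemma suppp_lower bl : suppp (block_union bl) (lowerp bl).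
Proof.
elim: bl => [|[B b] bl IH] //=.
rewrite suppp_cat suppp_opp !suppp_mul //.
- exact: suppp_elem.
- exact: suppp_upper.
- exact: suppp_trunc.
Qed.

Section BlockBounds.
Variable h : nat -> R.
Hypothesis h01 : forall p, 0 <= h p <= 1.
Let h_ge0 p : 0 <= h p. Proof. by case/andP: (h01 p). Qed.

Lemma lower_upper_bounds bl :
  evalp h (lowerp bl) <= \prod_(p <- block_union bl) (1 - h p) <= evalp h (upperp bl).
Proof.
elim: bl => [|[B b] bl IH] /=; first by rewrite evalp_one /block_union /= big_nil lexx.
rewrite /block_union /= big_cat -/(block_union bl) evalp_cat evalp_opp !evalp_mul.
have /andP[IH1 IH2] := IH; have /andP[t1 t2] := trunc_even_bounds B b h01.
have := sieve_prod_ge0 B h01; have := sieve_prod_ge0 (block_union bl) h01.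
move: t1 t2 IH1 IH2; have := evalp_elem_ge0 B b.*2.+1 h_ge0.
set V := \prod_(p <- B) _; set W := \prod_(p <- block_union bl) _.
set T := evalp _ (truncp _ _); set E := evalp _ (elemp _ _).
set L := evalp _ (lowerp _); set U := evalp _ (upperp _) => e0 t1 t2 l1 u1 w0 v0.
apply/andP; split; last by apply: ler_pM.
have : T * L <= T * W by apply: ler_wpM2l => //; exact: le_trans t1.
have : E * W <= E * U by apply: ler_wpM2l.
have : T * W <= (V + E) * W by apply: ler_wpM2r.
rewrite mulrDl => H1 H2 H3 /=; lra.
Qed.

End BlockBounds.

Lemma abs_lower_upper_le h bl : (forall p, 0 <= h p) ->
  evalp h (absp (lowerp bl)) <= \prod_(c <- bl) (1 + \sum_(p <- c.1) h p) ^+ c.2.*2.+1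
  /\ 0 <= evalp h (absp (upperp bl)) <= \prod_(c <- bl) (1 + \sum_(p <- c.1) h p) ^+ c.2.*2.+1.
Proof.
move=> h0; have ab0 W : 0 <= evalp h (absp W).
  rewrite /evalp big_map sumr_ge0 // => w _; rewrite mulr_ge0 //=.
  by apply: prodr_ge0.
rewrite ab0 /=.
elim: bl => [|[B b] bl [IH1 IH2]] /=; first by rewrite absp_one evalp_one big_nil lexx.
rewrite absp_cat absp_opp evalp_cat !absp_mul !evalp_mul big_cons /= absp_elem.
have := abs_trunc_le B b.*2 h0; have := evalp_elem_ge0 B b.*2.+1 h0.
have P0 : 0 <= \prod_(c <- bl) (1 + \sum_(p <- c.1) h p) ^+ c.2.*2.+1.
  by apply: prodr_ge0 => c _; rewrite exprn_ge0 // addr_ge0 // sumr_ge0.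
move: IH1 IH2 P0 (ab0 (truncp B b.*2)) (ab0 (upperp bl)) (ab0 (lowerp bl)).
set P := \prod_(c <- bl) _; set L := evalp _ (absp (lowerp _)); set U := evalp _ (absp (upperp _)).
set E := evalp _ (elemp _ _); set T := evalp _ _; set Q := _ ^+ _.
move=> l u p0 t0 u0 l0 e0 hQ.
have H : (T + E) * P <= Q * P by apply: ler_wpM2r.
have H1 : T * L <= T * P by apply: ler_wpM2l.
have H2 : E * U <= E * P by apply: ler_wpM2l.
have H3 : T * U <= T * P by apply: ler_wpM2l.
have H4 : 0 <= E * P by apply: mulr_ge0.
rewrite mulrDl in H; split; lra.
Qed.

(** * Sifting a family of events with block weights *)

Section BrunHooley.
Variables (T : seq nat) (E : nat -> nat -> bool) (X : R) (kappa : nat -> nat).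
Variable ps : seq nat.
Let g (p : nat) : R := (kappa p)%:R / p%:R.
Hypothesis ps_uniq : uniq ps.
Hypothesis count_hyp : forall D, uniq D -> {subset D <= ps} ->
  `|(count (fun n => all (E^~ n) D) T)%:R - X * \prod_(p <- D) g p|
    <= \prod_(p <- D) (kappa p)%:R.

Let ev (n : nat) (W : sieve_poly) : R := evalp (fun p => (E p n)%:R) W.

Lemma sum_evalp_bound B W : uniq B -> {subset B <= ps} -> suppp B W ->
  `|\sum_(n <- T) ev n W - X * evalp g W|
    <= evalp (fun p => (kappa p)%:R) (absp W).
Proof.
move=> uB sB /allP sW.
rewrite /ev /evalp exchange_big /= mulr_sumr -sumrB big_map /=.
rewrite big_seq [X in _ <= X]big_seq; apply: le_trans (ler_norm_sum _ _ _) _.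
apply: ler_sum => w /sW ws.
have -> : \sum_(n <- T) w.1 * \prod_(p <- w.2) (E p n)%:R
   = w.1 * (count (fun n => all (E^~ n) w.2) T)%:R.
  rewrite -mulr_sumr -sum1_count natr_sum [in RHS]big_mkcond /=; congr (_ * _).
  apply: eq_bigr => n _; elim: (w.2) => [|p D IH]; first by rewrite big_nil.
  by rewrite big_cons IH /=; case: (E p n); rewrite ?mul1r ?mul0r.
rewrite mulrCA -mulrBr normrM ler_wpM2l // count_hyp //.
  exact: subseq_uniq ws uB.
by move=> p /(mem_subseq ws)/sB.
Qed.

Variable bl : seq (seq nat * nat).
Hypothesis bl_perm : perm_eq (block_union bl) ps.

Let err : R := \prod_(c <- bl) (1 + \sum_(p <- c.1) (kappa p)%:R) ^+ c.2.*2.+1.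
Let sifted : R := (count (fun n => all (fun p => ~~ E p n) ps) T)%:R.

Lemma sifted_bounds :
  X * evalp g (lowerp bl) - err <= sifted <= X * evalp g (upperp bl) + err.
Proof.
have uB : uniq (block_union bl) by rewrite (perm_uniq bl_perm).
have sB : {subset block_union bl <= ps} by move=> p; rewrite (perm_mem bl_perm).
have E01 n p : 0 <= ((E p n)%:R : R) <= 1 by case: (E p n); rewrite ?lexx ?ler01.
have k0 p : 0 <= (kappa p)%:R :> R by rewrite ler0n.
have -> : sifted = \sum_(n <- T) \prod_(p <- block_union bl) (1 - (E p n)%:R).
  rewrite /sifted -sum1_count natr_sum [LHS]big_mkcond /=; apply: eq_bigr => n _.
  rewrite (perm_big _ bl_perm) /=; elim: (ps) => [|p D IH]; first by rewrite big_nil.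
  by rewrite big_cons -IH /=; case: (E p n); rewrite ?subrr ?subr0 ?mul1r ?mul0r.
have [a1 /andP[_ a2]] := abs_lower_upper_le bl k0.
have := sum_evalp_bound uB sB (suppp_upper bl).
have := sum_evalp_bound uB sB (suppp_lower bl).
rewrite !ler_norml => /andP[b1 _] /andP[_ b2].
have c1 : \sum_(n <- T) ev n (lowerp bl) <= \sum_(n <- T) \prod_(p <- block_union bl) (1 - (E p n)%:R).
  by apply: ler_sum => n _; have /andP[] := lower_upper_bounds (E01 n) bl.
have c2 : \sum_(n <- T) \prod_(p <- block_union bl) (1 - (E p n)%:R) <= \sum_(n <- T) ev n (upperp bl).
  by apply: ler_sum => n _; have /andP[] := lower_upper_bounds (E01 n) bl.
by move: a1 a2 b1 b2 c1 c2; rewrite -/err => *; apply/andP; split; lra.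
Qed.

End BrunHooley.

(** There is no cut at the bottom: the last block keeps whatever is left, namely the primes below
    4. *)
Fixpoint dyadic_blocks (J : nat) (ps : seq nat) (b : nat) : seq (seq nat * nat) :=
  if J is J'.+1 then
    ([seq p <- ps | 2 ^ 2 ^ J <= p]%N, b)
      :: dyadic_blocks J' [seq p <- ps | p < 2 ^ 2 ^ J]%N b.+1
  else [:: (ps, b)].

Lemma perm_dyadic_blocks J ps b : perm_eq (block_union (dyadic_blocks J ps b)) ps.
Proof.
elim: J ps b => [|J IH] ps b; rewrite /block_union /=; first by rewrite cats0.
rewrite -/(block_union _) perm_sym -(perm_filterC (fun p => 2 ^ 2 ^ J.+1 <= p)%N) perm_sym.
rewrite perm_cat2l; apply: perm_trans (IH _ _) _.
by rewrite (eq_filter (a2 := predC (fun p => 2 ^ 2 ^ J.+1 <= p)%N)) // => p; rewrite /= -ltnNge.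
Qed.

Lemma mem_dyadic_blocks J ps b c :
  (forall p, p \in ps -> 2 <= p < 2 ^ 2 ^ J.+1)%N -> c \in dyadic_blocks J ps b ->
  [/\ subseq c.1 ps, (b <= c.2)%N &
    exists j, forall p, p \in c.1 -> (2 ^ 2 ^ j <= p < 2 ^ 2 ^ j.+1)%N].
Proof.
elim: J ps b => [|J IH] ps b hps /=.
  by rewrite inE => /eqP-> /=; split => //; exists 0%N.
rewrite inE => /predU1P[->|] /=.
  split; rewrite ?filter_subseq //; exists J.+1 => p; rewrite mem_filter.
  by case/andP=> -> /hps /andP[].
case/IH => [p|h1 h2 h3].
  by rewrite mem_filter => /andP[-> /hps /andP[->]].
split => //; last exact: ltnW.
by apply: subseq_trans h1 (filter_subseq _ _).
Qed.

Section MainTerm.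
Variable g : nat -> R.
Hypothesis g01 : forall p, 0 <= g p <= 1.

(** With e = 2^-b, the top block loses a factor 1 + e/2 and the others, by induction at b.+1, a
    factor 1 + e; and (1 + e/2)(1 + e) <= 1 + 2e as e <= 1. The lower weight is compared with the
    upper weight rather than with V, since the correction in [lowerp] carries the upper weight of
    the remaining blocks; it loses e/2 twice. *)
Lemma dyadic_main_term J ps b :
  (forall c, c \in dyadic_blocks J ps b ->
     evalp g (elemp c.1 c.2.*2.+1) <= (1 / 2) ^+ c.2.+1 * \prod_(p <- c.1) (1 - g p)) ->
  let bl := dyadic_blocks J ps b in
  let V := \prod_(p <- block_union bl) (1 - g p) in
  evalp g (upperp bl) <= V * (1 + 2 * (1 / 2) ^+ b) /\
  (1 - (1 / 2) ^+ b) * evalp g (upperp bl) <= evalp g (lowerp bl).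
Proof.
have g0 p : 0 <= g p by case/andP: (g01 p).
elim: J ps b => [|J IH] ps b h /=.
  have := h (ps, b) (mem_head _ _); rewrite /= /block_union /= cats0 => he.
  rewrite evalp_cat evalp_opp !evalp_mul !evalp_one !mulr1 -/(elemp _ _).
  have /andP[t1 t2] := trunc_even_bounds ps b g01.
  have V0 := sieve_prod_ge0 ps g01.
  move: he t1 t2 V0; rewrite exprS.
  have : 0 <= (1 / 2) ^+ b :> R by rewrite exprn_ge0 // divr_ge0.
  set e := (1 / 2) ^+ b; set V := \prod_(_ <- _) _; set t := evalp _ (truncp _ _).
  set el := evalp _ _ => e0 he t1 t2 V0.
  have : 0 <= e * V by apply: mulr_ge0.
  have : e * V <= e * t by apply: ler_wpM2l.
  by move=> h1 h2; split; nra.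
have /IH {IH} [] : forall c, c \in dyadic_blocks J [seq p <- ps | (p < 2 ^ 2 ^ J.+1)%N] b.+1 ->
     evalp g (elemp c.1 c.2.*2.+1) <= (1 / 2) ^+ c.2.+1 * \prod_(p <- c.1) (1 - g p).
  by move=> c hc; apply: h; rewrite /= inE hc orbT.
set bl := dyadic_blocks _ _ _; have {h} := h _ (mem_head _ _).
rewrite /= /block_union /= big_cat /= -/(block_union bl).
set B := [seq _ <- _ | _] => he u1 l1.
rewrite evalp_cat evalp_opp !evalp_mul -/(elemp _ _).
have /andP[t1 t2] := trunc_even_bounds B b g01.
have V0 := sieve_prod_ge0 B g01; have W0 := sieve_prod_ge0 (block_union bl) g01.
have /andP[_ u0] := lower_upper_bounds g01 bl.
move: he t1 t2 V0 W0 u0; rewrite !exprS.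
have : 0 <= (1 / 2) ^+ b :> R by rewrite exprn_ge0 // divr_ge0.
have : (1 / 2) ^+ b <= 1 :> R.
  by rewrite exprn_ile1 ?divr_ge0 // ler_pdivrMr // mul1r ler1n.
move: u1 l1; rewrite exprS.
set e := (1 / 2) ^+ b; set V := \prod_(_ <- B) _; set W := \prod_(_ <- block_union _) _.
set t := evalp _ (truncp _ _); set el := evalp _ (elemp _ _).
set U := evalp _ (upperp _); set L := evalp _ (lowerp _).
move=> u1 l1 e1 e0 he t1 t2 V0 W0 u0.
have VW : 0 <= V * W by apply: mulr_ge0.
have t0 : 0 <= t by apply: le_trans t1.
have U0 : 0 <= U by apply: le_trans u0.
have H1 : t * U <= (V * (1 + e / 2)) * (W * (1 + e)) by apply: ler_pM => //; lra.
have H2 : V * W * e * e <= V * W * e by rewrite ler_piMr // mulr_ge0.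
have H3 : t * ((1 - 1 / 2 * e) * U) <= t * L by apply: ler_wpM2l.
have H4 : el * U <= (1 / 2 * e * V) * U by apply: ler_wpM2r.
have H5 : e * U * V <= e * U * t by apply: ler_wpM2l => //; apply: mulr_ge0.
by split; lra.
Qed.

End MainTerm.

(** Over a block 2k bounds the sum of the densities and exp (-4k) bounds the sieve product from
    below, so this is the condition of [dyadic_main_term] on a block; the factorial wins over the
    power. *)
Lemma pow_fact_decay k : exists b0, (0 < b0)%N /\ forall b, (b0 <= b)%N ->
  (2 * k%:R) ^+ b.*2.+1 / (b.*2.+1)`!%:R <= (1 / 2) ^+ b.+1 * exp (- (4 * k%:R)).
Proof.
have e0 : Rlt 0 (exp (- (4 * k%:R))) by exact: exp_pos.
have [N hN] := cv_speed_pow_fact (4 * k%:R)%R _ e0.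
exists N.+1; split=> // b Nb.
have /hN : ge b.*2.+1 N by apply/ssrnat.leP; lia.
rewrite /R_dist /Rdist RabsE RpowE INRE factE RdivE RminusE subr0 => /RltP /(le_lt_trans (ler_norm _)) /ltW h.
have -> : 2 * k%:R = (1 / 2) * (4 * k%:R) :> R by field.
rewrite exprMn -mulrA; apply: ler_pM.
- by rewrite exprn_ge0 // divr_ge0.
- by rewrite divr_ge0 ?exprn_ge0 ?mulr_ge0.
- rewrite ler_wiXn2l ?divr_ge0 //; last by rewrite -addnn ltnS leq_addr.
  by rewrite ler_pdivrMr // mul1r ler1n.
- exact: h.
Qed.

(** From (1 - t)(1 + t + 2t^2) = 1 + t^2 (1 - 2t) >= 1 and 1 + v <= exp v. *)
Lemma exp_le_1sub (t : R) : 0 <= t -> t <= 1 / 2 -> exp (- (t + 2 * t ^+ 2)) <= 1 - t.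
Proof.
move=> t0 t1; have h := expR_ge1D (t + 2 * t ^+ 2).
have e0 := exp_gt0 (t + 2 * t ^+ 2).
have E : exp (- (t + 2 * t ^+ 2)) = (exp (t + 2 * t ^+ 2))^-1 := exp_Ropp _.
rewrite E -div1r ler_pdivrMr //.
apply: (@le_trans _ _ ((1 - t) * (1 + (t + 2 * t ^+ 2)))); last by rewrite ler_wpM2l //; lra.
have : 0 <= t ^+ 2 * (1 - 2 * t) by rewrite mulr_ge0 ?sqr_ge0 //; lra.
lra.
Qed.

Section DyadicBlocks.
Variables (k : nat) (kappa : nat -> nat).
Let g (p : nat) : R := (kappa p)%:R / p%:R.

Lemma dyadic_block_bound j b (B : seq nat) : uniq B ->
  (forall p, p \in B -> [/\ prime p, (k.*2 < p)%N & (kappa p <= k)%N]) ->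
  (forall p, p \in B -> (2 ^ 2 ^ j <= p < 2 ^ 2 ^ j.+1)%N) ->
  (2 * k%:R) ^+ b.*2.+1 / (b.*2.+1)`!%:R <= (1 / 2) ^+ b.+1 * exp (- (4 * k%:R)) ->
  (forall p, 0 <= g p) ->
  evalp g (elemp B b.*2.+1) <= (1 / 2) ^+ b.+1 * \prod_(p <- B) (1 - g p).
Proof.
move=> uB hB rB hb g0.
have sum_recip : \sum_(p <- B) p%:R^-1 <= 2 :> R.
  apply: (@block_recip (2 ^ j)) => //; first by rewrite expn_gt0.
  by move=> p pB; have [-> _ _] := hB p pB; rewrite -mul2n -expnS rB.
have sum_g : \sum_(p <- B) g p <= 2 * k%:R.
  apply: (@le_trans _ _ (k%:R * \sum_(p <- B) p%:R^-1)).
    rewrite mulr_sumr big_seq [X in _ <= X]big_seq; apply: ler_sum => p /hB [_ _ hk].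
    by rewrite ler_wpM2r ?invr_ge0 // ler_nat.
  by rewrite mulrC ler_wpM2r.
have hg p : p \in B -> g p <= 1 / 2.
  move=> /hB [pp kp hk]; have p0 : 0 < p%:R :> R by rewrite ltr0n prime_gt0.
  rewrite ler_pdivrMr // mulrAC mul1r ler_pdivlMr // -natrM ler_nat.
  by rewrite muln2; apply: leq_trans (ltnW kp); rewrite leq_double.
(* Since g <= 1/2, the exponent g + 2g^2 is at most 2g, and the g sum to at most 2k. *)
have V_ge : exp (- (4 * k%:R)) <= \prod_(p <- B) (1 - g p).
  apply: (@le_trans _ _ (exp (\sum_(p <- B) - (2 * g p)))).
    by apply: ler_exp; rewrite sumrN -mulr_sumr lerN2; lra.
  rewrite exp_sum big_seq [X in _ <= X]big_seq; apply: ler_prod => p pB.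
  rewrite (ltW (exp_gt0 _)) /=; apply: le_trans (exp_le_1sub (g0 p) (hg p pB)).
  apply: ler_exp; rewrite lerN2.
  have := g0 p; have := hg p pB; nra.
apply: (@le_trans _ _ ((2 * k%:R) ^+ b.*2.+1 / (b.*2.+1)`!%:R)).
  rewrite ler_pdivlMr ?ltr0n ?fact_gt0 //; apply: le_trans (elem_le_pow B _ g0) _.
  by rewrite lerXn2r ?nnegrE ?mulr_ge0 ?sumr_ge0.
by apply: le_trans hb _; rewrite ler_wpM2l // exprn_ge0 // divr_ge0.
Qed.

Lemma block_sum_le M (B : seq nat) : (0 < M)%N -> uniq B ->
  (forall p, p \in B -> [/\ (k.*2 < p)%N, (p < M)%N & (kappa p <= k)%N]) ->
  1 + \sum_(p <- B) (kappa p)%:R <= (M ^ 2)%:R :> R.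
Proof.
move=> M0 uB hB; rewrite -natr_sum nat1r ler_nat.
case: B uB hB => [|p0 B'] uB hB; first by rewrite big_nil expn_gt0 M0.
set B := p0 :: B' in uB hB *.
have [h1 h2 _] := hB p0 (mem_head _ _).
have sB : (size B <= M)%N.
  rewrite -(size_iota 0 M); apply: uniq_leq_size => // p /hB [_ pM _].
  by rewrite mem_iota.
have : (\sum_(p <- B) kappa p <= \sum_(p <- B) k)%N.
  by rewrite big_seq [X in (_ <= X)%N]big_seq; apply: leq_sum => p /hB [].
rewrite big_const_seq count_predT iter_addn_0 => h3.
apply: leq_ltn_trans h3 _; rewrite -mulnn.
apply: (@leq_ltn_trans (k * M)%N); first by rewrite leq_mul2l sB orbT.
by rewrite ltn_pmul2r //; apply: leq_ltn_trans h2; apply: leq_trans (ltnW h1); rewrite -addnn leq_addr.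
Qed.

(** The exponent solves f(b) = (4b + 2) + f(b + 1)/2: the top block costs 4b + 2, and the rest is
    the same problem at b + 1 with the square root of the bound. *)
Lemma dyadic_error J ps b : uniq ps ->
  (forall p, p \in ps -> [/\ (k.*2 < p)%N, (p < 2 ^ 2 ^ J.+1)%N & (kappa p <= k)%N]) ->
  \prod_(c <- dyadic_blocks J ps b) (1 + \sum_(p <- c.1) (kappa p)%:R) ^+ c.2.*2.+1
    <= (2 ^ 2 ^ J.+1)%:R ^+ (8 * b + 12) :> R.
Proof.
have blk J' b' B : uniq B ->
    (forall p, p \in B -> [/\ (k.*2 < p)%N, (p < 2 ^ 2 ^ J')%N & (kappa p <= k)%N]) ->
    (1 + \sum_(p <- B) (kappa p)%:R) ^+ b'.*2.+1 <= (2 ^ 2 ^ J')%:R ^+ (4 * b' + 2) :> R.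
  move=> uB hB; have -> : (4 * b' + 2 = 2 * b'.*2.+1)%N by lia.
  rewrite exprM lerXn2r ?nnegrE ?addr_ge0 ?sumr_ge0 ?exprn_ge0 //.
  by rewrite -natrX block_sum_le ?expn_gt0.
have one_le J' : 1 <= (2 ^ 2 ^ J')%:R :> R by rewrite ler1n expn_gt0.
elim: J ps b => [|J IH] ps b ups hps.
  rewrite [dyadic_blocks _ _ _]/= big_seq1 /=; apply: le_trans (blk 1%N b ps ups hps) _.
  by rewrite ler_weXn2l //; lia.
rewrite [dyadic_blocks _ _ _]/= big_cons [(_, _).1]/= [(_, _).2]/=.
have -> : (8 * b + 12 = (4 * b + 2) + (4 * b + 10))%N by lia.
rewrite exprD; apply: ler_pM.
- by rewrite exprn_ge0 // addr_ge0 ?sumr_ge0.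
- by apply: prodr_ge0 => c _; rewrite exprn_ge0 // addr_ge0 ?sumr_ge0.
- apply: blk; first by rewrite filter_uniq.
  by move=> p; rewrite mem_filter => /andP[_ /hps].
apply: le_trans (IH _ b.+1 _ _) _; first by rewrite filter_uniq.
  by move=> p; rewrite mem_filter => /andP[h /hps []].
have -> : (2 ^ 2 ^ J.+2 = (2 ^ 2 ^ J.+1) ^ 2)%N by rewrite -expnM -expnSr.
by rewrite [X in _ <= X ^+ _]natrX -exprM ler_weXn2l //; lia.
Qed.

End DyadicBlocks.

Lemma dyadic_tower z : (2 <= z)%N -> exists J, (z <= 2 ^ 2 ^ J.+1 <= z ^ 2)%N.
Proof.
move=> z2; have ex : exists J, (z <= 2 ^ 2 ^ J.+1)%N.
  exists z; apply: leq_trans (ltnW (ltn_expl z (isT : 1 < 2)%N)) _.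
  rewrite leq_exp2l //; apply: leq_trans (ltnW (ltn_expl z (isT : 1 < 2)%N)) _.
  by rewrite leq_exp2l.
case: (ex_minnP ex) => J zJ minJ; exists J; rewrite zJ /=.
case: J zJ minJ => [|J] zJ minJ; first by rewrite -[(2 ^ _)%N]/(2 ^ 2)%N leq_exp2r.
have -> : (2 ^ 2 ^ J.+2 = (2 ^ 2 ^ J.+1) ^ 2)%N by rewrite -expnM -expnSr.
rewrite leq_exp2r // leqNgt; apply/negP => h.
by have := minJ J (ltnW h); rewrite ltnn.
Qed.

Theorem brun_hooley (k : nat) : exists e : nat, (0 < e)%N /\
  forall (T : seq nat) (E : nat -> nat -> bool) (X : R) (kappa : nat -> nat)
    (ps : seq nat) (z : nat),
  (2 <= z)%N -> 0 <= X -> uniq ps ->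
  (forall p, p \in ps -> [/\ prime p, (k.*2 < p)%N, (p < z)%N & (kappa p <= k)%N]) ->
  (forall D, uniq D -> {subset D <= ps} ->
     `|(count (fun n => all (E^~ n) D) T)%:R - X * \prod_(p <- D) ((kappa p)%:R / p%:R)|
       <= \prod_(p <- D) (kappa p)%:R) ->
  forall sifted V : R, sifted = (count (fun n => all (fun p => ~~ E p n) ps) T)%:R ->
  V = \prod_(p <- ps) (1 - (kappa p)%:R / p%:R) ->
  X * V / 2 - z%:R ^+ e <= sifted <= 2 * X * V + z%:R ^+ e.
Proof.
have [b0 [b0_gt0 hb0]] := pow_fact_decay k.
(* [8 * b0 + 12] is the exponent in [dyadic_error]; the factor 2 pays for rounding z up to some 2 ^
   2 ^ J.+1 <= z^2. *)
exists (2 * (8 * b0 + 12))%N; split; first by lia.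
move=> T E X kappa0 ps z z2 X0 ups hps0 hcount sifted V siftedE VE0.
(* Cut off outside [ps], so that the density lies in [0, 1] at every index, as the bounds on the
   weights require. *)
pose kappa p := if p \in ps then kappa0 p else 0%N.
pose g (p : nat) : R := (kappa p)%:R / p%:R.
have kE p : p \in ps -> kappa p = kappa0 p by rewrite /kappa => ->.
have hps p : p \in ps -> [/\ prime p, (k.*2 < p)%N, (p < z)%N & (kappa p <= k)%N].
  by move=> pps; rewrite kE //; apply: hps0.
have g01 p : 0 <= g p <= 1.
  rewrite /g /kappa; case: ifP => [/hps0 [pp kp _ hk]|_]; last by rewrite mul0r lexx ler01.
  rewrite divr_ge0 //= ler_pdivrMr ?ltr0n ?prime_gt0 // mul1r ler_nat.
  by apply: leq_trans hk _; apply: leq_trans (ltnW kp); rewrite -addnn leq_addr.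
have [J /andP[zJ Jz]] := dyadic_tower z2.
pose bl := dyadic_blocks J ps b0.
have blP : perm_eq (block_union bl) ps := perm_dyadic_blocks J ps b0.
have hps2 p : p \in ps -> (2 <= p < 2 ^ 2 ^ J.+1)%N.
  by move=> /hps [pp _ pz _]; rewrite prime_gt1 //= (leq_trans pz).
have := @sifted_bounds T E X kappa ps ups _ bl blP.
rewrite -siftedE; set err := \prod_(c <- bl) _ => hs.
have {hs} /andP[s1 s2] : X * evalp g (lowerp bl) - err <= sifted <= X * evalp g (upperp bl) + err.
  apply: hs => D uD sD.
  rewrite (eq_big_seq (fun p => (kappa0 p)%:R / p%:R)) => [|p /sD pps]; last by rewrite kE.
  rewrite [X in _ <= X](eq_big_seq (fun p => (kappa0 p)%:R)) => [|p /sD pps]; last by rewrite kE.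
  exact: hcount.
have err_le : err <= z%:R ^+ (2 * (8 * b0 + 12)).
  apply: le_trans (dyadic_error (k := k) (kappa := kappa) b0 (J := J) ups _) _.
    by move=> p pps; have [_ -> _ ->] := hps p pps; have /andP[_ ->] := hps2 p pps.
  by rewrite exprM lerXn2r ?nnegrE ?exprn_ge0 // -natrX ler_nat.
have [|u l] := @dyadic_main_term g g01 J ps b0.
  move=> c /(mem_dyadic_blocks hps2) [sc bc [j hj]].
  apply: (@dyadic_block_bound k kappa j) => //.
  - exact: subseq_uniq sc ups.
  - by move=> p /(mem_subseq sc) /hps [].
  - exact: hb0.
  - by move=> p; case/andP: (g01 p).
have VE : \prod_(p <- block_union bl) (1 - g p) = V.
  by rewrite VE0 (perm_big _ blP) /=; apply: eq_big_seq => p pps; rewrite /g kE.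
have /andP[_ Vu] := lower_upper_bounds g01 bl.
move: u l Vu s1 s2; rewrite -/bl VE; set U := evalp _ (upperp _); set L := evalp _ (lowerp _).
have V0 : 0 <= V by rewrite -VE sieve_prod_ge0.
(* b0 >= 1 turns the losses 1 + 2e and 1 - e into the factors 2 and 1/2. *)
have : (1 / 2) ^+ b0 <= 1 / 2 :> R.
  by rewrite -[X in _ <= X]expr1 ler_wiXn2l ?divr_ge0 // ler_pdivrMr // mul1r ler1n.
set e := (1 / 2) ^+ b0 => e2 u l Vu s1 s2.
have h1 : V * (2 * e) <= V * 1 by rewrite ler_wpM2l //; lra.
have h2 : e * U <= 1 / 2 * U by rewrite ler_wpM2r // (le_trans V0).
have h3 : X * U <= X * (2 * V) by rewrite ler_wpM2l //; lra.
have h4 : X * (V / 2) <= X * L by rewrite ler_wpM2l //; lra.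
move: err_le; set Z := _ ^+ (_ * _) => err_le.
by apply/andP; split; lra.
Qed.

(** * Residue classes and linear forms *)

Lemma natr_count (T : Type) (P : pred T) (s : seq T) :
  (count P s)%:R = \sum_(x <- s) (P x)%:R :> R.
Proof.
elim: s => [|x s IH]; first by rewrite big_nil.
by rewrite big_cons /= natrD IH.
Qed.

Lemma count_mod N q c : (0 < q)%N ->
  `|(count (fun n => n == c %[mod q])%N (iota 1 N))%:R - N%:R / q%:R| <= 1 :> R.
Proof.
(* The range starts at 1, so the zero class is represented by q; with c' in [1, q] the count is
   exactly (N + q - c') %/ q. *)
move=> q0; pose c' := if (c %% q == 0)%N then q else (c %% q)%N.
have c'0 : (0 < c')%N by rewrite /c'; case: ifP => // /negbT; rewrite lt0n.
have c'q : (c' <= q)%N by rewrite /c'; case: ifP => // _; rewrite ltnW ?ltn_pmod.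
have c'E : (c' %% q = c %% q)%N.
  by rewrite /c'; case: ifP => [/eqP->|_]; rewrite ?modnn ?modn_mod.
have E : count (fun n => n == c %[mod q])%N (iota 1 N) = ((N + q - c') %/ q)%N.
  elim: N => [|N IH]; first by rewrite add0n divn_small // ltn_subrL c'0.
  have -> : iota 1 N.+1 = iota 1 N ++ [:: N.+1] by rewrite -[X in iota 1 X = _]addn1 iotaD add1n.
  rewrite count_cat IH addnC /= addn0 addSn subSn; last by rewrite (leq_trans c'q) ?leq_addl.
  rewrite divnS // -subSn; last by rewrite (leq_trans c'q) ?leq_addl.
  congr (_ + _)%N; rewrite -eqn_mod_dvd; last first.
    by apply: leqW; rewrite (leq_trans c'q) ?leq_addl.
  by rewrite -addSn modnDr c'E.
rewrite {}E; have q0' : 0 < q%:R :> R by rewrite ltr0n.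
have h1 : ((N + q - c') %/ q * q <= N + q)%N.
  by apply: leq_trans (leq_divM _ _) _; rewrite leq_subr.
have h2 : (N <= ((N + q - c') %/ q).+1 * q)%N.
  by apply: leq_trans (ltnW (ltn_ceil _ q0)); rewrite -addnBA // leq_addr.
move: h1 h2; set C := (_ %/ q)%N; rewrite -!(ler_nat R) !natrM natrD -natr1 => h1 h2.
rewrite ler_norml lerBrDl lerBlDl -(ler_pM2r q0') -[X in _ && X](ler_pM2r q0').
by rewrite !mulrDl mulNr !divfK ?gt_eqF //; apply/andP; split; lra.
Qed.

(** The Chinese remainder theorem moves the primes of D into the modulus one at a time, splitting
    the class into one class modulo q p for each allowed residue. Each final class is counted with
    error at most 1. *)
Lemma count_residues N (Rs : nat -> seq nat) D q c : (0 < q)%N -> uniq D ->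
  (forall p, p \in D -> [/\ prime p, coprime p q & uniq (Rs p)]) ->
  (forall p r, p \in D -> r \in Rs p -> (r < p)%N) ->
  `|(count (fun n => (n == c %[mod q]) && all (fun p => n %% p \in Rs p) D)%N (iota 1 N))%:R
     - N%:R / q%:R * \prod_(p <- D) ((size (Rs p))%:R / p%:R)|
   <= \prod_(p <- D) (size (Rs p))%:R :> R.
Proof.
elim: D q c => [|p D IH] q c q0 /=.
  rewrite !big_nil mulr1 => _ _ _; under eq_count do rewrite andbT.
  exact: count_mod.
case/andP=> pD uD hD rD; have [pp pq uR] := hD p (mem_head _ _).
have p0 := prime_gt0 pp; have p0' : 0 < p%:R :> R by rewrite ltr0n.
have q0' : 0 < q%:R :> R by rewrite ltr0n.
have qp : coprime q p by rewrite coprime_sym.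
pose F r n := ((n == chinese q p c r %[mod q * p]) && all (fun p => n %% p \in Rs p) D)%N.
have -> : (count (fun n => (n == c %[mod q]) && ((n %% p \in Rs p) &&
     all (fun p => n %% p \in Rs p) D))%N (iota 1 N))%:R
   = \sum_(r <- Rs p) (count (F r) (iota 1 N))%:R :> R.
  rewrite natr_count; under [RHS]eq_bigr do rewrite natr_count.
  rewrite exchange_big /=; apply: eq_bigr => n _.
  rewrite -natr_count; congr (_%:R).
  rewrite /F.
  transitivity (count (fun r => [&& n == c %[mod q], r == n %% p & all (fun p => n %% p \in Rs p) D]%N) (Rs p)).
    case: (n == _ %[mod q])%N => /=; last by rewrite count_pred0.
    case: (all _ _).
      by rewrite andbT -(count_uniq_mem _ uR); apply: eq_count => r; rewrite andbT.
    by rewrite andbF; under eq_count do rewrite andbF; rewrite count_pred0.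
  apply: eq_in_count => r rR; rewrite (chinese_remainder qp) (chinese_modl qp) (chinese_modr qp).
  by rewrite (modn_small (rD p r (mem_head _ _) rR)) [(r == _)%N]eq_sym andbA.
rewrite !big_cons.
set P := \prod_(p <- D) _; set K := \prod_(p <- D) _.
have H r : `|(count (F r) (iota 1 N))%:R - N%:R / (q * p)%N%:R * P| <= K.
  apply: IH => //; first by rewrite muln_gt0 q0.
    move=> p' p'D; have [pp' cp' uR'] := hD p' (mem_behead (s := _ :: _) p'D).
    split => //; rewrite coprimeMr cp' /= prime_coprime // dvdn_prime2 //.
    by apply: contraNneq pD => <-.
  by move=> p' r' p'D; apply: rD; rewrite inE p'D orbT.
have -> : N%:R / q%:R * ((size (Rs p))%:R / p%:R * P)
   = \sum_(r <- Rs p) N%:R / (q * p)%N%:R * P.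
  rewrite big_const_seq count_predT iter_addr addr0 -[RHS]mulr_natl natrM.
  by field; rewrite !gt_eqF.
rewrite -sumrB; apply: le_trans (ler_norm_sum _ _ _) _.
apply: (@le_trans _ _ (\sum_(r <- Rs p) K)); first exact: ler_sum.
by rewrite big_const_seq count_predT iter_addr addr0 -[X in X <= _]mulr_natl.
Qed.

Section LinearForms.
Variables (k : nat) (a b : 'I_k -> int).

Definition dvdL (p : nat) (i : 'I_k) (n : nat) : bool := (p%:Z %| Lform a b i n%:Z)%Z.

Lemma dvdL_mod p i n : dvdL p i (n %% p) = dvdL p i n.
Proof.
rewrite /dvdL /Lform {2}(divn_eq n p) PoszD PoszM mulrDr -addrA mulrA.
by rewrite [in RHS]rpredDl // dvdz_mull.
Qed.

(** The root is -b_i times the inverse of a_i. The modulus is general so that squares of primes are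
    covered too. *)
Lemma dvdL_root p i : (0 < p)%N -> coprimez p (a i) ->
  exists2 r, (r < p)%N & forall n, dvdL p i n = (n %% p == r)%N.
Proof.
move=> p0 cop; have pz : p%:Z != 0 by rewrite eqz_nat -lt0n.
have [[u v] /= uv] := coprimezP _ _ cop.
pose r := `|((- b i * v) %% p)%Z|%N.
have rE : r%:Z = ((- b i * v) %% p)%Z by rewrite /r gez0_abs // modz_ge0.
have rp : (r < p)%N by rewrite -ltz_nat rE ltz_mod.
have rroot : dvdL p i r.
  rewrite /dvdL /Lform rE.
  have -> : a i * ((- b i * v) %% p)%Z + b i =
     p%:Z * (u * b i - a i * ((- b i * v) %/ p)%Z).
    have := divz_eq (- b i * v) p; set Q := (_ %/ _)%Z; set M := (_ %% _)%Z => E.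
    have -> : M = - b i * v - Q * p%:Z by rewrite E; ring.
    by rewrite -[X in _ + X]mulr1 -uv; ring.
  by rewrite dvdz_mulr.
exists r => // n; rewrite -dvdL_mod.
have np : (n %% p < p)%N by rewrite ltn_pmod.
move: (n %% p)%N np => m mp; apply/idP/eqP => [h|-> //].
have : (p%:Z %| a i * (m%:Z - r%:Z))%Z.
  have -> : a i * (m%:Z - r%:Z) = Lform a b i m - Lform a b i r by rewrite /Lform; ring.
  by rewrite rpredB.
by rewrite Gauss_dvdzr // -eqz_mod_dvd !modz_nat eqz_nat !modn_small // => /eqP.
Qed.

Variable p : nat.
Hypothesis p_prime : prime p.
Hypothesis p_a : forall i, ~~ (p%:Z %| a i)%Z.
Hypothesis p_det : forall i j : 'I_k, i != j -> ~~ (p%:Z %| a i * b j - a j * b i)%Z.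

Definition residues (I : seq 'I_k) : seq nat :=
  [seq r <- iota 0 p | has (fun i => dvdL p i r) I].

Lemma mem_residues I n : (n %% p \in residues I)%N = has (fun i => dvdL p i n) I.
Proof.
rewrite mem_filter mem_iota add0n ltn_pmod ?prime_gt0 // !andbT.
by apply: eq_has => i; rewrite dvdL_mod.
Qed.

(** Distinct forms have distinct roots: a common root r would make p divide a_i L_j(r) - a_j L_i(r),
    which is the determinant a_i b_j - a_j b_i. *)
Lemma size_residues I : uniq I -> size (residues I) = size I.
Proof.
move=> uI.
have /fin_all_exists [root rootP] i : exists r, (r < p)%N /\ forall n, dvdL p i n = (n %% p == r)%N.
  have cop : coprimez p (a i) by rewrite coprimezE /= prime_coprime //; exact: p_a.
  by have [r] := dvdL_root (prime_gt0 p_prime) cop; exists r.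
have root_inj : injective root.
  move=> i j ij; apply/eqP; apply: contraT => /p_det /negP; case.
  have [ip iE] := rootP i; have [_ jE] := rootP j.
  have hi : dvdL p i (root i) by rewrite iE modn_small.
  have hj : dvdL p j (root i) by rewrite jE -ij modn_small.
  have -> : a i * b j - a j * b i =
     a i * Lform a b j (root i) - a j * Lform a b i (root i) by rewrite /Lform; ring.
  by rewrite rpredB // dvdz_mull.
rewrite -(size_map root I); apply/perm_size/uniq_perm; first by rewrite filter_uniq ?iota_uniq.
  by rewrite map_inj_uniq.
move=> r; rewrite mem_filter mem_iota add0n /=; apply/andP/mapP => [[/hasP[i iI]]|[i iI ->]].
  move=> h rp; exists i => //; have [_ iE] := rootP i.
  by rewrite iE modn_small // in h; apply/eqP.
have [ip iE] := rootP i; split => //.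
by apply/hasP; exists i => //; rewrite iE modn_small.
Qed.

End LinearForms.

(** The generic behaviour of a prime: k distinct roots modulo p, and a density k/p below 1/2. *)
Definition separated_at (k : nat) (a b : 'I_k -> int) (p : nat) : Prop :=
  [/\ prime p, (k.*2 < p)%N, forall i, ~~ (p%:Z %| a i)%Z
    & forall i j : 'I_k, i != j -> ~~ (p%:Z %| a i * b j - a j * b i)%Z].

(** Having [e] fixed before the forms, N and z is what makes the later constants uniform. The lists
    [I p] allow different primes to sift different forms, for the count of rough values; the class c
    modulo q serves when a prime of P is prescribed as a divisor. *)
Definition sieve_exponent (k e : nat) : Prop :=
  forall (a b : 'I_k -> int) (I : nat -> seq 'I_k) (ps : seq nat) (N z q c : nat),
  (2 <= z)%N -> (0 < q)%N -> uniq ps -> (forall p, uniq (I p)) ->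
  (forall p, p \in ps -> [/\ separated_at a b p, (p < z)%N & coprime p q]) ->
  forall S V : R,
  S = (count (fun n => (n == c %[mod q]) &&
        all (fun p => ~~ has (fun i => dvdL a b p i n) (I p)) ps)%N (iota 1 N))%:R ->
  V = \prod_(p <- ps) (1 - (size (I p))%:R / p%:R) ->
  N%:R / q%:R * V / 2 - z%:R ^+ e <= S <= 2 * (N%:R / q%:R) * V + z%:R ^+ e.

Theorem sieve_linear_forms (k : nat) : exists e : nat, (0 < e)%N /\ sieve_exponent k e.
Proof.
have [e [e0 he]] := brun_hooley k; exists e; split => //.
move=> a b I ps N z q c z2 q0 ups uI hps S V SE VE.
apply: (he [seq n <- iota 1 N | n == c %[mod q]]%N
  (fun p n => has (fun i => dvdL a b p i n) (I p)) _ (fun p => size (I p)) ps z) => //.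
- by rewrite divr_ge0.
- move=> p /hps [[pp kp _ _] pz _]; split => //.
  by rewrite -[X in (_ <= X)%N](card_ord k) -(card_uniqP (uI p)) max_card.
- move=> D uD sD.
  have hD p : p \in D -> size (residues a b p (I p)) = size (I p).
    by move=> /sD /hps [[pp kp ha hd] _ _]; apply: size_residues.
  have := @count_residues N (fun p => residues a b p (I p)) D q c q0 uD _ _.
  rewrite (eq_big_seq (fun p => (size (I p))%:R / p%:R)) => [|p /hD ->//].
  rewrite [X in _ -> _ -> _ <= X](eq_big_seq (fun p => (size (I p))%:R)) => [|p /hD ->//] h.
  apply: le_trans (h _ _).
  + rewrite count_filter; set u := count _ _; set v := count _ _; suff -> : u = v by [].
    apply: eq_count => n /=; rewrite andbC; congr (_ && _).
    apply: eq_in_all => p /sD /hps [[pp kp ha hd] _ _]; by rewrite mem_residues.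
  + move=> p /sD /hps [[pp _ _ _] _ ?]; split => //.
    by rewrite filter_uniq ?iota_uniq.
  + by move=> p r _; rewrite mem_filter mem_iota => /andP[_ /andP[]].
- rewrite SE count_filter; congr (_%:R); apply: eq_count => n /=.
  by rewrite andbC.
Qed.

(** * Size of the sieve density *)

Lemma sum_inv_sq_le a n : (0 < a)%N ->
  \sum_(a.+1 <= m < n) (m%:R ^+ 2)^-1 <= a%:R^-1 :> R.
Proof.
move=> a0; have a0' : 0 < a%:R :> R by rewrite ltr0n.
case: (leqP n a.+1) => [na|]; first by rewrite big_geq // invr_ge0.
move=> /ltnW /subnKC <-; move: (n - a.+1)%N => {n} l.
suff : \sum_(a.+1 <= m < a.+1 + l) (m%:R ^+ 2)^-1 <= a%:R^-1 - (a + l)%:R^-1 :> R.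
  by move=> h; apply: le_trans h _; rewrite gerBl invr_ge0.
elim: l => [|l IH]; first by rewrite !addn0 big_geq // subrr.
rewrite addnS big_nat_recr ?leq_addr //=; apply: le_trans (lerD IH (lexx _)) _.
have h0 : 0 < (a + l)%:R :> R by rewrite ltr0n addn_gt0 a0.
rewrite addnS addSn -[(a + l).+1%:R]natr1; move: h0 {IH}; move: ((a + l)%:R : R) => t h0.
have t1 : 0 < t + 1 by rewrite addr_gt0.
suff : ((t + 1) ^+ 2)^-1 <= t^-1 - (t + 1)^-1 by lra.
have -> : t^-1 - (t + 1)^-1 = (t * (t + 1))^-1 by field; rewrite !gt_eqF.
by rewrite lef_pV2 ?posrE ?exprn_gt0 ?mulr_gt0 // expr2 ler_wpM2r ?(ltW t1) // lerDl.
Qed.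

Definition primes_outside (S : seq nat) (M : nat) : seq nat :=
  [seq p <- iota 0 M | prime p && (p \notin S)].

Lemma mem_primes_outside S M p :
  (p \in primes_outside S M) = [&& prime p, p \notin S & (p < M)%N].
Proof. by rewrite mem_filter mem_iota add0n /= andbA. Qed.

Lemma uniq_primes_outside S M : uniq (primes_outside S M).
Proof. by rewrite filter_uniq ?iota_uniq. Qed.

Lemma sieve_density_lower k : exists c : R, 0 < c /\ forall S M, (2 <= M)%N ->
  (forall p, p \in primes_outside S M -> (k.*2 < p)%N) ->
  c / ln M%:R ^+ k <= \prod_(p <- primes_outside S M) (1 - k%:R / p%:R).
Proof.
have [C hC] := mertens_second.
(* k C comes from [mertens_second]; 2 k^2 from the quadratic terms of [exp_le_1sub], as the sum of
   the 1/p^2 is at most 1. *)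
exists (exp (- (k%:R * C + 2 * k%:R ^+ 2))); split; first exact: exp_gt0.
move=> S M M2 hS; set ps := primes_outside S M.
have l0 : 0 < ln M%:R :> R by rewrite ln_gt0 // ltr1n.
have L : exp (- (k%:R * ln (ln M%:R))) = (ln M%:R ^+ k)^-1 :> R.
  have -> : exp (- (k%:R * ln (ln M%:R))) = (exp (k%:R * ln (ln M%:R)))^-1 := exp_Ropp _.
  by rewrite -lnXn // expK_ln // exprn_gt0.
have in_ps p : p \in ps -> [/\ prime p, (p < M)%N & (k.*2 < p)%N].
  by move=> pps; have := hS p pps; move: pps; rewrite mem_primes_outside => /and3P[].
have s1 : \sum_(p <- ps) p%:R^-1 <= ln (ln M%:R) + C.
  apply: le_trans (hC M M2); rewrite -[X in _ <= X]big_filter; apply: ler_sum_subset.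
  - exact: uniq_primes_outside.
  - by move=> p /in_ps [pp pM _]; rewrite mem_filter pp mem_index_iota leqW.
  - by move=> p; rewrite invr_ge0.
have s2 : \sum_(p <- ps) (p%:R ^+ 2)^-1 <= 1 :> R.
  apply: le_trans (le_trans (sum_inv_sq_le M (isT : 0 < 1)%N) _); last by rewrite invr1.
  apply: ler_sum_subset; first exact: uniq_primes_outside.
  - by move=> p /in_ps [pp pM _]; rewrite mem_index_iota prime_gt1.
  - by move=> p; rewrite invr_ge0 exprn_ge0.
rewrite -L -expD.
apply: (@le_trans _ _ (exp (\sum_(p <- ps) - (k%:R / p%:R + 2 * (k%:R / p%:R) ^+ 2)))).
  apply: ler_exp; rewrite sumrN -opprD lerN2 big_split /= -mulr_sumr.
  have -> : \sum_(p <- ps) 2 * (k%:R / p%:R) ^+ 2 = 2 * k%:R ^+ 2 * \sum_(p <- ps) (p%:R ^+ 2)^-1 :> R.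
    by rewrite mulr_sumr; apply: eq_bigr => p _; rewrite exprMn exprVn mulrA.
  move: s1 s2; set A := \sum_(p <- ps) _; set B := \sum_(p <- ps) _ => s1 s2.
  have : k%:R * A <= k%:R * (ln (ln M%:R) + C) by rewrite ler_wpM2l.
  have : k%:R ^+ 2 * B <= k%:R ^+ 2 * 1 by rewrite ler_wpM2l ?exprn_ge0.
  rewrite mulrDr => *; lra.
rewrite exp_sum big_seq [X in _ <= X]big_seq; apply: ler_prod => p /in_ps [pp _ kp].
rewrite (ltW (exp_gt0 _)) /=; apply: exp_le_1sub; first by rewrite divr_ge0.
rewrite ler_pdivrMr ?ltr0n ?prime_gt0 // mulrAC mul1r ler_pdivlMr // -natrM ler_nat.
by rewrite muln2 ltnW.
Qed.

(** Each prime of S missing from the product has 1 - 1/p >= 1/2, so the full Mertens product is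
    changed by at most a factor 2 per element of S. *)
Lemma mertens_outside S M : uniq S -> (2 <= M)%N ->
  \prod_(p <- primes_outside S M) (1 - p%:R^-1) <= 2 ^+ size S / ln M%:R :> R.
Proof.
move=> uS M2; have l0 : 0 < ln M%:R :> R by rewrite ln_gt0 // ltr1n.
rewrite ler_pdivlMr //.
have M0 : (0 < M)%N by apply: leq_trans M2.
have := mertens_third M0; rewrite -big_filter (bigID (fun p => p \in S)) /=.
have -> : \prod_(p <- [seq p <- index_iota 0 M | prime p] | p \notin S) (1 - p%:R^-1)
    = \prod_(p <- primes_outside S M) (1 - p%:R^-1) :> R.
  rewrite -big_filter -filter_predI /index_iota subn0; congr bigop.
  by apply: eq_filter => p /=; rewrite andbC.
set A := \prod_(_ <- [seq _ <- _ | _] | _) _; set B := \prod_(_ <- primes_outside _ _) _ => h.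
have half p : prime p -> 1 / 2 <= 1 - p%:R^-1 :> R.
  move=> pp; have : p%:R^-1 <= 2^-1 :> R.
    by rewrite lef_pV2 ?posrE ?ltr0n ?prime_gt0 // ler_nat prime_gt1.
  lra.
have B0 : 0 <= B.
  rewrite /B big_seq prodr_ge0 // => p; rewrite mem_primes_outside => /and3P[/half h2 _ _].
  by apply: le_trans h2; rewrite divr_ge0.
have hA : (1 / 2) ^+ size S <= A.
  rewrite /A -big_filter; set T := [seq _ <- _ | _].
  have TP p : p \in T -> prime p && (p \in S).
    by rewrite !mem_filter => /and3P[h1 h2 _]; apply/andP.
  have sT : (size T <= size S)%N.
    apply: uniq_leq_size; first by rewrite !filter_uniq ?iota_uniq.
    by move=> p /TP /andP[].
  apply: (@le_trans _ _ ((1 / 2) ^+ size T)).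
    by rewrite ler_wiXn2l ?divr_ge0 // ler_pdivrMr // mul1r ler1n.
  elim: T TP {sT} => [|p T IH] TP; first by rewrite big_nil.
  rewrite big_cons exprS; apply: ler_pM; rewrite ?exprn_ge0 ?divr_ge0 //.
    by apply: half; have /andP[] := TP p (mem_head _ _).
  by apply: IH => q qT; apply: TP; rewrite inE qT orbT.
have p2 : 0 < 2 ^+ size S :> R by rewrite exprn_gt0.
have h1 : 1 <= 2 ^+ size S * A.
  apply: le_trans (ler_wpM2l (ltW p2) hA).
  by rewrite -exprMn mulrCA divff ?pnatr_eq0 // mulr1 expr1n.
have h2 : 2 ^+ size S * (A * B * ln M%:R) <= 2 ^+ size S * 1 by rewrite ler_wpM2l // ltW.
have h3 : B * ln M%:R <= (2 ^+ size S * A) * (B * ln M%:R).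
  by rewrite ler_peMl // mulr_ge0 // ltW.
rewrite mulr1 in h2; apply: le_trans h3 _; apply: le_trans h2.
by rewrite !mulrA.
Qed.

Lemma sieve_factor_le (k p : nat) : prime p ->
  1 - k%:R / p%:R <= (1 - p%:R^-1) ^+ k :> R.
Proof.
move=> pp; have p0 : 0 < p%:R^-1 :> R by rewrite invr_gt0 ltr0n prime_gt0.
have p1 : p%:R^-1 <= 1 :> R by rewrite invf_le1 ?ler1n ?ltr0n prime_gt0.
elim: k => [|k IH]; first by rewrite mul0r subr0 expr0.
rewrite exprS; apply: (@le_trans _ _ ((1 - p%:R^-1) * (1 - k%:R / p%:R))); last first.
  by rewrite ler_wpM2l // subr_ge0.
rewrite -natr1; have : 0 <= k%:R * p%:R^-1 * p%:R^-1 :> R by rewrite !mulr_ge0 // ltW.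
set t := p%:R^-1; lra.
Qed.

Lemma sieve_density_upper k S M : uniq S -> (2 <= M)%N ->
  (forall p, p \in primes_outside S M -> (k.*2 < p)%N) ->
  \prod_(p <- primes_outside S M) (1 - k%:R / p%:R)
    <= (2 ^+ size S / ln M%:R) ^+ k :> R.
Proof.
move=> uS M2 hS; have H := mertens_outside uS M2.
apply: (@le_trans _ _ ((\prod_(p <- primes_outside S M) (1 - p%:R^-1)) ^+ k)).
  rewrite -prodrXl big_seq [X in _ <= X]big_seq; apply: ler_prod => p pM.
  have kp := hS p pM; have := pM; rewrite mem_primes_outside => /and3P[pp _ _].
  rewrite sieve_factor_le // andbT subr_ge0 ler_pdivrMr ?ltr0n ?prime_gt0 // mul1r ler_nat.
  by apply: leq_trans (ltnW kp); rewrite -addnn leq_addr.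
have l0 : 0 < ln M%:R :> R by rewrite ln_gt0 // ltr1n.
rewrite lerXn2r ?nnegrE ?divr_ge0 ?exprn_ge0 ?(ltW l0) //.
rewrite big_seq prodr_ge0 // => p; rewrite mem_primes_outside => /and3P[pp _ _].
by rewrite subr_ge0 invf_le1 ?ler1n ?ltr0n prime_gt0.
Qed.

(** Below M the factor 1 - (k + 1)/p is at most (1 - 1/p)^k (1 - 1/p): one copy of Mertens' product
    runs up to M', the k others stop at M. *)
Lemma sieve_density_upper_mixed k S M M' : uniq S -> (2 <= M)%N -> (M <= M')%N ->
  (forall p, p \in primes_outside S M' -> (k.+1.*2 < p)%N) ->
  \prod_(p <- primes_outside S M') (1 - (if (p < M)%N then k.+1 else 1%N)%:R / p%:R)
    <= (2 ^+ size S / ln M%:R) ^+ k * (2 ^+ size S / ln M'%:R) :> R.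
Proof.
move=> uS M2 MM' hS; have M'2 := leq_trans M2 MM'.
have inv1 p : prime p -> 0 <= 1 - p%:R^-1 :> R.
  by move=> pp; rewrite subr_ge0 invf_le1 ?ler1n ?ltr0n prime_gt0.
have l0 : 0 < ln M%:R :> R by rewrite ln_gt0 // ltr1n.
have sub_eq : [seq p <- primes_outside S M' | (p < M)%N] =
    primes_outside S M.
  rewrite /primes_outside -filter_predI -(subnKC MM') iotaD filter_cat.
  rewrite [X in _ ++ X](_ : _ = [::]) ?cats0.
    by apply: eq_in_filter => p; rewrite mem_iota => /andP[_ pM] /=; rewrite pM.
  rewrite -(filter_pred0 (iota (0 + M) (M' - M))).
  by apply: eq_in_filter => p; rewrite mem_iota add0n => /andP[pM _] /=; rewrite ltnNge pM.
apply: (@le_trans _ _ ((\prod_(p <- primes_outside S M) (1 - p%:R^-1)) ^+ k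
   * \prod_(p <- primes_outside S M') (1 - p%:R^-1))).
  rewrite -sub_eq big_filter -prodrXl [X in _ <= X * _]big_mkcond -big_split /=.
  rewrite big_seq [X in _ <= X]big_seq; apply: ler_prod => p pM.
  have kp := hS p pM; have := pM; rewrite mem_primes_outside => /and3P[pp _ _].
  have p0 : 0 < p%:R :> R by rewrite ltr0n prime_gt0.
  case: ifP => _.
    rewrite -exprSr sieve_factor_le // andbT subr_ge0 ler_pdivrMr // mul1r ler_nat.
    by apply: leq_trans (ltnW kp); rewrite -addnn leq_addr.
  by rewrite !mul1r inv1 /=.
apply: ler_pM.
- by rewrite exprn_ge0 // big_seq prodr_ge0 // => p; rewrite mem_primes_outside => /and3P[/inv1].
- by rewrite big_seq prodr_ge0 // => p; rewrite mem_primes_outside => /and3P[/inv1].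
- rewrite lerXn2r ?nnegrE ?divr_ge0 ?exprn_ge0 ?(ltW l0) ?mertens_outside //.
  by rewrite big_seq prodr_ge0 // => p; rewrite mem_primes_outside => /and3P[/inv1].
- exact: mertens_outside.
Qed.

(** * The sets Omega and Omega_1 *)

Lemma pbP (P : Prop) : reflect P (pb P).
Proof. by rewrite /pb; case: ClassicalDescription.excluded_middle_informative => h; constructor. Qed.

(** Trades the real sifting level for an integer one with the same primes below it. *)
Lemma nat_ceil_exists (z : R) : exists M, forall p : nat, (p < M)%N = (p%:R < z).
Proof.
have ex : exists M : nat, z <= M%:R.
  exists (Num.bound `|z|).
  exact: le_trans (ler_norm z) (ltW (archi_boundP (normr_ge0 z))).
case: (ex_minnP ex) => M zM minM; exists M => p; apply/idP/idP => [pM|].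
  by rewrite ltNge; apply/negP => /minM; rewrite leqNgt pM.
by move=> /lt_le_trans /(_ zM); rewrite ltr_nat.
Qed.

Lemma nfloor_bounds (x : R) : 0 <= x -> (nfloor x)%:R <= x /\ x < (nfloor x).+1%:R.
Proof.
move=> /RleP; rewrite -R0E => x0; have [h1 h2] := base_Int_part x.
have I0 : Z.le Z0 (Int_part x).
  have : Z.lt (Zneg xH) (Int_part x); last by lia.
  by apply: lt_IZR; move: h2; rewrite /= => h2; Lra.lra.
have E : INR (nfloor x) = IZR (Int_part x) by rewrite /nfloor INR_IZR_INZ Znat.Z2Nat.id.
rewrite -natr1 -!INRE E; split; first by apply/RleP.
by apply/RltP; rewrite -RplusE -R1E; Lra.lra.
Qed.

Lemma dvdz_Lprod (k : nat) (a b : 'I_k -> int) p n : prime p ->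
  (p%:Z %| Lprod a b n%:Z)%Z = has (fun i => dvdL a b p i n) (enum 'I_k).
Proof.
move=> pp; rewrite dvdzE /= /Lprod (big_morph _ abszM (erefl : absz 1 = 1%N)).
rewrite Euclid_dvd_prod // -big_enum big_has.
by apply: eq_has.
Qed.

Lemma in_OmegaP (k : nat) (a b : 'I_k -> int) Sigma z M n : (forall p : nat, (p < M)%N = (p%:R < z)) ->
  reflect (in_Omega Sigma a b z n)
    (all (fun p => ~~ has (fun i => dvdL a b p i n) (enum 'I_k)) (primes_outside Sigma M)).
Proof.
move=> hM; rewrite /in_Omega coprimezE /=; set s := primes_outside _ _.
suff -> : coprime `|Lprod a b n| (PSigma Sigma z) =
  all (fun p => ~~ has (fun i => dvdL a b p i n) (enum 'I_k)) s by exact: idP.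
have -> : PSigma Sigma z = (\prod_(p <- s) p)%N.
  rewrite /PSigma -big_filter; apply: perm_big; apply: uniq_perm.
  - by rewrite filter_uniq ?iota_uniq.
  - exact: uniq_primes_outside.
  move=> p; rewrite mem_filter mem_primes_outside mem_index_iota -andbA /= hM.
  case: (prime p) => //=; case: (p \in Sigma) => //=.
  have [pz|pz] := pbP; last by apply/esym/negP => /RltP; rewrite -INRE.
  have -> : p%:R < z by apply/RltP; rewrite -INRE.
  have [h _] := archimed z.
  have : Z.lt (Z.of_nat p) (up z) by apply: lt_IZR; rewrite -INR_IZR_INZ; Lra.lra.
  by move=> h'; lia.
have sp p : p \in s -> prime p by rewrite mem_primes_outside => /and3P[].
elim: s sp => [|p s IH] sp; first by rewrite big_nil coprimen1.
rewrite big_cons coprimeMr IH /=; last by move=> q qs; apply: sp; rewrite inE qs orbT.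
have pp := sp p (mem_head _ _); congr (_ && _).
by rewrite coprime_sym prime_coprime // -(dvdz_Lprod a b n pp).
Qed.

Section Setup.
Variables (k : nat) (Sigma : seq nat) (a b : 'I_k -> int).
Hypothesis Sigma_prime : all prime Sigma.
Hypothesis ab_coprime : forall i, gcdz (a i) (b i) = 1%N.
Hypothesis ab_unit : sigma_unit Sigma
  ((k.*2)`!%:Z * (\prod_(i < k) a i) *
     \prod_(i < k) \prod_(j < k | (i < j)%N) (a i * b j - a j * b i)).
Hypothesis Sigma_a : forall i p, p \in Sigma -> (p%:Z %| a i)%Z.

(** The unit hypothesis is used factor by factor: (2k)! excludes p <= 2k, the [a i] keep the forms
    nonconstant modulo p, the determinants keep their roots apart. *)
Lemma separated_outside p : prime p -> p \notin Sigma -> separated_at a b p.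
Proof.
move=> pp pS.
have det (i j : 'I_k) : (i < j)%N -> ~~ (p%:Z %| a i * b j - a j * b i)%Z.
  move=> ij; apply: contra pS => h; apply: ab_unit => //; apply: dvdz_mull.
  rewrite (bigD1 i) //=; apply: dvdz_mulr; rewrite (bigD1 j) //=; exact: dvdz_mulr.
split => //.
- rewrite ltnNge; apply: contra pS => h; apply: ab_unit => //.
  by rewrite -mulrA; apply: dvdz_mulr; rewrite dvdzE /= dvdn_fact // prime_gt0.
- move=> i; apply: contra pS => h; apply: ab_unit => //.
  by apply: dvdz_mulr; apply: dvdz_mull; rewrite (bigD1 i) //=; apply: dvdz_mulr.
- move=> i j ij; have [lt|lt|e] := ltngtP i j; first exact: det.
    by rewrite -opprB dvdzE abszN -dvdzE; apply: det.
  by rewrite (val_inj e) eqxx in ij.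
Qed.

(** As p divides [a i], dividing the value would mean dividing [b i], against coprimality. *)
Lemma Sigma_not_dvdL p i n : p \in Sigma -> ~~ dvdL a b p i n.
Proof.
move=> pS; have pp := allP Sigma_prime p pS; apply/negP; rewrite /dvdL /Lform.
rewrite rpredDl; last by apply: dvdz_mulr; exact: Sigma_a.
move=> h; have : (p%:Z %| gcdz (a i) (b i))%Z by rewrite dvdz_gcd Sigma_a.
by rewrite ab_coprime dvdzE /= dvdn1 => /eqP p1; rewrite p1 in pp.
Qed.

End Setup.

Lemma count_has_le (T U : Type) (P : T -> U -> bool) (s : seq U) (t : seq T) :
  (count (fun n => has (P n) s) t <= \sum_(p <- s) count (P^~ p) t)%N.
Proof.
elim: s => [|p s IH]; first by rewrite big_nil /= count_pred0.
rewrite big_cons; apply: leq_trans (leq_add (leqnn _) IH).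
by rewrite -count_predUI; apply: leq_trans (leq_addr _ _).
Qed.

Section Counting.
Variables (k e : nat) (Sigma : seq nat) (a b : 'I_k -> int).
Hypothesis exponent_e : sieve_exponent k e.
Hypothesis Sigma_uniq : uniq Sigma.
Hypothesis Sigma_prime : all prime Sigma.
Hypothesis a_neq0 : forall i, a i != 0.
Hypothesis Sigma_ndvd : forall i p n, p \in Sigma -> ~~ dvdL a b p i n.
Hypothesis outside : forall p, prime p -> p \notin Sigma -> separated_at a b p.

Lemma count_small_value i M N :
  (count (fun n => `|Lform a b i n%:Z| < M)%N (iota 1 N) <= 2 * M)%N.
Proof.
rewrite -size_filter; set s := [seq _ <- _ | _].
rewrite -(size_map (fun n : nat => Lform a b i n%:Z)).
pose t : seq int := map Posz (iota 0 M) ++ map (fun n => - Posz n) (iota 0 M).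
have -> : (2 * M = size t)%N by rewrite size_cat !size_map size_iota mul2n addnn.
apply: uniq_leq_size.
  rewrite map_inj_uniq ?filter_uniq ?iota_uniq // => x y /addIr /(mulfI (a_neq0 i)) [].
  by [].
move=> y /mapP[n]; rewrite mem_filter => /andP[h _ ->]; rewrite mem_cat.
move: h; case: (Lform _ _ _ _) => m /= h; apply/orP; [left|right]; apply/mapP.
  by exists m => //; rewrite mem_iota.
by exists m.+1; rewrite ?mem_iota // NegzE.
Qed.

Lemma coprime_outside p i : prime p -> p \notin Sigma -> coprime p `|a i|.
Proof. by move=> pp /(outside pp) [_ _ pa _]; rewrite prime_coprime //; exact: pa. Qed.

(** For each p a single class modulo p^2 is hit, by at most N/p^2 + 1 numbers. The tail of the 1/p^2
    gives 2N/M and the ones add up to at most Q. *)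
Lemma count_square_divisor i M Q N : (2 <= M)%N ->
  (count (fun n => has (fun p => [&& prime p, p \notin Sigma & dvdL a b (p ^ 2) i n])
     (index_iota M Q)) (iota 1 N))%:R <= 2 * N%:R / M%:R + Q%:R :> R.
Proof.
move=> M2.
have [M' ME] : exists M', M = M'.+2 by case: M M2 => [|[|M']] // _; exists M'.
have M0 : 0 < M%:R :> R by rewrite ltr0n (ltnW M2).
apply: (@le_trans _ _ (\sum_(M <= p < Q) (N%:R * (p%:R ^+ 2)^-1 + 1))).
  apply: le_trans (_ : _ <= (\sum_(M <= p < Q) count (fun n =>
     [&& prime p, p \notin Sigma & dvdL a b (p ^ 2) i n]) (iota 1 N))%N%:R) _.
    by rewrite ler_nat; apply: count_has_le.
  rewrite natr_sum; apply: ler_sum => p _.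
  have [pp|_] := boolP (prime p); last by rewrite count_pred0 addr_ge0 // mulr_ge0 // invr_ge0 exprn_ge0.
  have [pS|pS] := boolP (p \in Sigma); first by rewrite count_pred0 addr_ge0 // mulr_ge0 // invr_ge0 exprn_ge0.
  have p2 : (0 < p ^ 2)%N by rewrite expn_gt0 prime_gt0.
  have cop : coprimez (p ^ 2)%N (a i) by rewrite coprimezE coprimeXl // coprime_outside.
  have [r _ hr] := dvdL_root b p2 cop.
  have := count_mod N r p2; rewrite ler_norml => /andP[_].
  rewrite lerBlDl natrX; apply: le_trans; rewrite ler_nat; apply: sub_count => n /=.
  by rewrite hr => /eqP <-; rewrite modn_mod.
rewrite big_split /= -mulr_sumr; apply: lerD; last first.
  by rewrite sumr_const_nat -mulr_natl mulr1 ler_nat leq_subr.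
rewrite mulrAC mulrC ler_wpM2r // {1}ME; apply: le_trans (sum_inv_sq_le Q (isT : 0 < M'.+1)%N) _.
rewrite -div1r ler_pdivrMr ?ltr0n // mulrAC ler_pdivlMr // mul1r -natrM ler_nat; lia.
Qed.

Lemma sifted_lower M N : (2 <= M)%N ->
  N%:R * \prod_(p <- primes_outside Sigma M) (1 - k%:R / p%:R) / 2 - M%:R ^+ e
  <= (count (fun n => all (fun p => ~~ has (fun i => dvdL a b p i n) (enum 'I_k))
                          (primes_outside Sigma M)) (iota 1 N))%:R :> R.
Proof.
move=> M2; have sep p : p \in primes_outside Sigma M -> [/\ separated_at a b p, (p < M)%N & coprime p 1].
  by rewrite mem_primes_outside => /and3P[pp pS pM]; split; rewrite ?coprimen1 //; exact: outside.
have /andP[] := @exponent_e a b (fun=> enum 'I_k) _ N M 1 0 M2 isT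
  (uniq_primes_outside Sigma M) (fun=> enum_uniq _) sep _ _ erefl erefl.
rewrite divr1 size_enum_ord; under eq_count do rewrite !modn1 eqxx.
by [].
Qed.

Lemma sifted_upper_class M N q c : (2 <= M)%N -> (0 < q)%N ->
  (forall p, p \in primes_outside Sigma M -> coprime p q) ->
  (count (fun n => (n == c %[mod q])%N && all (fun p => ~~ has (fun i => dvdL a b p i n) (enum 'I_k))
                          (primes_outside Sigma M)) (iota 1 N))%:R
  <= 2 * (N%:R / q%:R) * (2 ^+ size Sigma / ln M%:R) ^+ k + M%:R ^+ e :> R.
Proof.
move=> M2 q0 cop; have sep p : p \in primes_outside Sigma M ->
    [/\ separated_at a b p, (p < M)%N & coprime p q].
  move=> pM; have := pM; rewrite mem_primes_outside => /and3P[pp pS ltpM].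
  by split; rewrite ?cop //; exact: outside.
have /andP[_ h] := @exponent_e a b (fun=> enum 'I_k) _ N M q c M2 q0
  (uniq_primes_outside Sigma M) (fun=> enum_uniq _) sep _ _ erefl erefl.
apply: le_trans h _; rewrite lerD2r ler_wpM2l ?mulr_ge0 ?invr_ge0 //.
by rewrite size_enum_ord sieve_density_upper // => p /sep [[]].
Qed.

Lemma sifted_upper_mixed i M M' N : (2 <= M)%N -> (M <= M')%N ->
  (count (fun n => all (fun p => ~~ has (fun i => dvdL a b p i n)
                                  (if (p < M)%N then enum 'I_k else [:: i]))
                          (primes_outside Sigma M')) (iota 1 N))%:R
  <= 2 * N%:R * ((2 ^+ size Sigma / ln M%:R) ^+ k.-1 * (2 ^+ size Sigma / ln M'%:R)) + M'%:R ^+ e :> R.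
Proof.
move=> M2 MM'; have M'2 := leq_trans M2 MM'.
have sep p : p \in primes_outside Sigma M' ->
    [/\ separated_at a b p, (p < M')%N & coprime p 1].
  move=> pM; have := pM; rewrite mem_primes_outside => /and3P[pp pS ltpM].
  by split; rewrite ?coprimen1 //; exact: outside.
have uI p : uniq (if (p < M)%N then enum 'I_k else [:: i]) by case: ifP => // _; rewrite enum_uniq.
have /andP[_] := @exponent_e a b _ _ N M' 1 0 M'2 isT
  (uniq_primes_outside Sigma M') uI sep _ _ erefl erefl.
rewrite divr1; under eq_count do rewrite !modn1 eqxx.
move=> h; apply: le_trans h _; rewrite lerD2r ler_wpM2l ?mulr_ge0 //.
have k0 : (k.-1.+1 = k)%N by rewrite prednK // (leq_ltn_trans _ (ltn_ord i)).
apply: le_trans (sieve_density_upper_mixed (k := k.-1) Sigma_uniq M2 MM' _); last first.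
  by rewrite k0 => p /sep [[]].
rewrite k0 le_eqVlt; apply/orP; left; apply/eqP; apply: eq_bigr => p _.
by case: ifP => _; rewrite ?size_enum_ord.
Qed.

End Counting.

(** * Omega_1 as the sifted set without its exceptional subsets *)

Section LowerBound.
Variables (k e : nat) (Sigma : seq nat) (a b : 'I_k -> int).
Hypothesis exponent_e : sieve_exponent k e.
Hypothesis Sigma_uniq : uniq Sigma.
Hypothesis Sigma_prime : all prime Sigma.
Hypothesis a_neq0 : forall i, a i != 0.
Hypothesis Sigma_ndvd : forall i p n, p \in Sigma -> ~~ dvdL a b p i n.
Hypothesis outside : forall p, prime p -> p \notin Sigma -> separated_at a b p.
Variables (x z : R) (M M' Q : nat).
Let N := nfloor x.
Hypothesis M2 : (2 <= M)%N.
Hypothesis MM' : (M <= M')%N.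
Hypothesis M_z : forall p : nat, (p < M)%N = (p%:R < z).
Hypothesis value_lt : forall i n, (n <= N)%N -> (`|Lform a b i n%:Z| < Q ^ 2)%N.

Let sifted n := all (fun p => ~~ has (fun i => dvdL a b p i n) (enum 'I_k)) (primes_outside Sigma M).
Let small i n := (`|Lform a b i n%:Z| < M')%N.
Let square i n := has (fun p => [&& prime p, p \notin Sigma & dvdL a b (p ^ 2) i n]) (index_iota M Q).
(** Catches the prime values: if n is sifted and |L_i(n)| is a prime at least M', no prime below M'
    outside Sigma divides it. Sifting the other forms up to M retains their factors 1 / ln z. *)
Let rough i n := all (fun p => ~~ has (fun i => dvdL a b p i n)
   (if (p < M)%N then enum 'I_k else [:: i])) (primes_outside Sigma M').

Lemma in_Omega1_sufficient n : (n <= N)%N -> sifted n ->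
  (forall i, ~~ [|| small i n, square i n | rough i n]) ->
  in_Omega1 Sigma a b z n.
Proof.
move=> nN sn hi; split; first exact/(in_OmegaP _ _ _ _ M_z).
move=> i; have := hi i; rewrite !negb_or -leqNgt => /and3P[large sqf nrough].
have L2 := leq_trans (leq_trans M2 MM') large.
have ndvd p : prime p -> dvdL a b p i n -> p \notin Sigma /\ (M <= p)%N.
  move=> pp pL; have pS : p \notin Sigma by apply: contraL pL; exact: Sigma_ndvd.
  split=> //; rewrite leqNgt; apply/negP => pM.
  have /(allP sn) /hasP[] : p \in primes_outside Sigma M.
    by rewrite mem_primes_outside pp pS.
  by exists i; rewrite ?mem_enum.
split.
  (* The unit part is 1: primes of Sigma never divide a value, so the value itself is square-free.
     The bound Q^2 on values confines p with p^2 dividing it to p < Q. *)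
  exists 1, (Lform a b i n%:Z); split; last split; last by rewrite mul1r.
    move=> p pp; rewrite dvdz1 /= => /eqP p1; by rewrite p1 in pp.
  move=> p pp p2L; have pL : dvdL a b p i n.
    by apply: dvdz_trans p2L; rewrite dvdzE /= expnS dvdn_mulr.
  have [pS pM] := ndvd p pp pL.
  move/negP: sqf; apply; apply/hasP; exists p; last by rewrite pp pS.
  rewrite mem_index_iota pM /= -(@ltn_exp2r _ _ 2) //.
  apply: leq_ltn_trans (value_lt i nN); apply: dvdn_leq => //.
  exact: ltnW.
split=> //; apply/negP => Lp; move/negP: nrough; apply.
apply/allP => p; rewrite mem_primes_outside => /and3P[pp pS pM'].
have nd : ~~ dvdL a b p i n.
  apply/negP; rewrite /dvdL dvdzE /= dvdn_prime2 // => /eqP pE.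
  by move: large; rewrite -pE leqNgt pM'.
case: ifP => pM; last by rewrite /= orbF.
by have := allP sn p; rewrite mem_primes_outside pp pS pM; apply.
Qed.

Lemma sifted_cover :
  (count sifted (iota 1 N) <= size (Omega1 Sigma a b x z) +
     \sum_(i <- enum 'I_k) (count (small i) (iota 1 N) + count (square i) (iota 1 N)
        + count (rough i) (iota 1 N)))%N.
Proof.
pose bad i n := [|| small i n, square i n | rough i n].
rewrite /Omega1 size_filter.
apply: (@leq_trans (count (fun n => pb (in_Omega1 Sigma a b z n)) (iota 1 N) +
   count (fun n => has (bad^~ n) (enum 'I_k)) (iota 1 N))%N); last first.
  rewrite leq_add2l; apply: leq_trans (count_has_le (fun n i => bad i n) _ _) _.
  apply: leq_sum => i _; rewrite -addnA.
  rewrite /bad.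
  apply: (@leq_trans (count (small i) (iota 1 N) + count (fun n => square i n || rough i n) (iota 1 N))%N).
    rewrite -count_predUI; exact: leq_addr.
  rewrite leq_add2l -count_predUI; exact: leq_addr.
rewrite -count_predUI; apply: leq_trans (leq_addr _ _).
rewrite -!size_filter; apply: uniq_leq_size; first by rewrite filter_uniq ?iota_uniq.
move=> n; rewrite !mem_filter => /andP[sn nN]; rewrite nN andbT /=.
have [//|hn] := boolP (has _ _); rewrite ?orbT // orbF.
apply/pbP; apply: in_Omega1_sufficient => //.
  by move: nN; rewrite mem_iota add1n ltnS => /andP[].
move=> i; apply: contra hn => hi; apply/hasP; exists i => //; by rewrite mem_enum.
Qed.

Lemma Omega1_lower :
  N%:R * \prod_(p <- primes_outside Sigma M) (1 - k%:R / p%:R) / 2 - M%:R ^+ e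
  - k%:R * (2 * M'%:R + (2 * N%:R / M%:R + Q%:R) +
     (2 * N%:R * ((2 ^+ size Sigma / ln M%:R) ^+ k.-1 * (2 ^+ size Sigma / ln M'%:R)) + M'%:R ^+ e))
  <= (size (Omega1 Sigma a b x z))%:R :> R.
Proof.
rewrite lerBlDr; apply: le_trans (sifted_lower exponent_e outside N M2) _.
apply: (@le_trans _ _ ((size (Omega1 Sigma a b x z) +
     \sum_(i <- enum 'I_k) (count (small i) (iota 1 N) + count (square i) (iota 1 N)
        + count (rough i) (iota 1 N)))%N%:R)).
  by rewrite ler_nat sifted_cover.
rewrite natrD lerD2l natr_sum.
set B := (X in _ * X).
have -> : k%:R * B = \sum_(i <- enum 'I_k) B.
  by rewrite big_const_seq count_predT size_enum_ord iter_addr addr0 mulr_natl.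
apply: ler_sum => i _; rewrite !natrD; apply: lerD; first apply: lerD.
- by rewrite -natrM ler_nat count_small_value.
- exact: (count_square_divisor Sigma_uniq Sigma_prime outside).
- exact: (sifted_upper_mixed exponent_e Sigma_uniq outside).
Qed.

End LowerBound.

(** exp (th t) is a product of k + 1 factors exp (d t) >= d t; k of them match t^k and the last one
    outgrows K. *)
Lemma exp_dominates_pow (k : nat) (K th : R) : 0 < th ->
  exists T : R, 1 <= T /\ forall t, T <= t -> K * t ^+ k <= exp (th * t).
Proof.
move=> th0; pose d := th / k.+1%:R.
have d0 : 0 < d by rewrite divr_gt0 ?ltr0n.
have dk0 : 0 < d ^+ k.+1 by rewrite exprn_gt0.
exists (Num.max 1 (K / d ^+ k.+1)); split; first by rewrite le_max lexx.
move=> t; rewrite ge_max => /andP[t1 Kt].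
have t0 : 0 <= t by apply: le_trans t1; rewrite ler01.
have -> : th * t = \sum_(i < k.+1) (d * t).
  by rewrite sumr_const card_ord -mulrnAl -mulr_natr /d divfK // pnatr_eq0.
rewrite exp_sum prodr_const card_ord.
apply: (@le_trans _ _ ((d * t) ^+ k.+1)); last first.
  have h : d * t <= exp (d * t) by apply: le_trans (expR_ge1D _); rewrite lerDr.
  have h0 : 0 <= d * t by apply: mulr_ge0 => //; exact: ltW.
  have h1 : 0 <= exp (d * t) by apply/ltW/exp_gt0.
  by rewrite lerXn2r ?nnegrE.
have -> : (d * t) ^+ k.+1 = (d ^+ k.+1 * t) * t ^+ k by rewrite exprMn [t ^+ k.+1]exprS mulrA.
by rewrite ler_wpM2r ?exprn_ge0 // mulrC -ler_pdivrMr.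
Qed.

(** The arithmetic hypotheses in the form in which the sieve consumes them. *)
Definition admissible (k : nat) (Sigma : seq nat) (a b : 'I_k -> int) : Prop :=
  [/\ uniq Sigma, all prime Sigma, forall i, a i != 0,
      forall i p n, p \in Sigma -> ~~ dvdL a b p i n
    & forall p, prime p -> p \notin Sigma -> separated_at a b p].

(** The size of the coefficients is felt only through A, and A only through the thresholds on z and
    x. *)
Lemma value_bound (k : nat) (a b : 'I_k -> int) : exists A : nat, (0 < A)%N /\
  forall i n N, (0 < N)%N -> (n <= N)%N -> (`|Lform a b i n%:Z| < A * N)%N.
Proof.
exists (\sum_i (`|a i| + `|b i|)).+1; split=> // i n N N0 nN; rewrite mulSn.
have h : (`|a i| + `|b i| <= \sum_i (`|a i| + `|b i|))%N by rewrite (bigD1 i) //= leq_addr.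
apply: (@leq_ltn_trans ((\sum_i (`|a i| + `|b i|)) * N)); last by rewrite -[X in (X < _)%N]add0n ltn_add2r.
apply: (@leq_trans ((`|a i| + `|b i|) * N)); last by rewrite leq_mul2r h orbT.
rewrite mulnDl /Lform; apply: (@leq_trans (`|a i * n%:Z| + `|b i|)).
  by rewrite -lez_nat PoszD !abszE ler_normD.
rewrite abszM /=.
by rewrite leq_add // ?leq_mul2l ?nN ?orbT // leq_pmulr.
Qed.

Lemma nat_ceil_bounds (z : R) M : (forall p : nat, (p < M)%N = (p%:R < z)) -> 1 <= z ->
  z <= M%:R /\ M%:R <= 2 * z.
Proof.
move=> hM z1; split; first by rewrite leNgt -hM ltnn.
case: M hM => [|M] hM; first by rewrite mulr_ge0 // (le_trans _ z1).
have : M%:R < z by rewrite -hM.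
by rewrite -natr1 => h; lra.
Qed.

Lemma nat_ceil_mono (z z' : R) M M' : (forall p : nat, (p < M)%N = (p%:R < z)) ->
  (forall p : nat, (p < M')%N = (p%:R < z')) -> z <= z' -> (M <= M')%N.
Proof.
move=> hM hM' zz'; rewrite leqNgt hM -leNgt; apply: le_trans zz' _.
by rewrite leNgt -hM' ltnn.
Qed.

(** [ln] is 0 on nonpositive reals, so a positive logarithm certifies x > 0; in part (a) positivity
    of x has to be drawn from z1 <= z <= exp (eta * ln x). *)
Lemma ln_gt0_pos (x : R) : 0 < ln x -> 0 < x.
Proof.
rewrite /ln; case: Rlt_dec => [h _|_]; first exact/RltP.
by rewrite -R0E ltxx.
Qed.

(** * Choice of eta and c1, and the lower bound of part (a) *)

Section PartA.
Variables (k s e : nat).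
Hypothesis k_gt0 : (0 < k)%N.
Hypothesis e_gt0 : (0 < e)%N.
Hypothesis exponent_e : sieve_exponent k e.

Lemma Omega1_lower_bound : exists eta c1 : R, [/\ 0 < eta, eta <= 1 / 2, 0 < c1, c1 <= 1 / 2 &
  forall Sigma (a b : 'I_k -> int), admissible Sigma a b -> size Sigma = s ->
  exists z1 : R, 2 <= z1 /\ forall x z : R, z1 <= z -> z <= exp (eta * ln x) ->
    c1 * x / ln z ^+ k <= (size (Omega1 Sigma a b x z))%:R].
Proof.
have [c [c0 hc]] := sieve_density_lower k.
have k0 : 0 < k%:R :> R by rewrite ltr0n.
have e0 : 0 < e%:R :> R by rewrite ltr0n.
pose D : R := 2 ^+ s; have D0 : 0 < D by rewrite exprn_gt0.
(* With y = x^eta0 the sieve error y^e is sqrt x. *)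
pose eta0 : R := (2 * e%:R)^-1.
have eta0_gt0 : 0 < eta0 by rewrite invr_gt0 mulr_gt0.
have eta0_le : eta0 <= 1 / 2.
  by rewrite div1r lef_pV2 ?posrE ?mulr_gt0 // ler_pMr // ler1n.
(* The 2^k comes from the integer level M <= 2z, for which ln M <= 2 ln z. *)
pose c2 : R := c / 2 ^+ k; have c20 : 0 < c2 by rewrite divr_gt0 ?exprn_gt0.
(* eta / eta0 <= r makes the rough values of all k forms together at most c2/8 of N / (ln z)^k. *)
pose r : R := c2 / (16 * k%:R * D ^+ k).
have r0 : 0 < r by rewrite divr_gt0 // mulr_gt0 ?mulr_gt0 ?exprn_gt0.
pose eta : R := eta0 * Num.min 1 r.
have min0 : 0 < Num.min 1 r by rewrite lt_min ltr01 r0.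
have eta_gt0 : 0 < eta by rewrite mulr_gt0.
have eta_le0 : eta <= eta0 by rewrite ger_pMr // ge_min lexx.
have eta_r : eta <= eta0 * r by rewrite ler_pM2l // ge_min lexx orbT.
(* Balance in units of 1 / (ln z)^k: main term N c2/2, minus N c2/8 for rough values and N c2/8 for
   square divisors, leaves at least x c2/8 as N >= x/2; the errors of order sqrt x take x c2/16. *)
pose c1 : R := Num.min (1 / 2) (c2 / 16).
exists eta, c1; split=> //.
- exact: le_trans eta_le0 eta0_le.
- by rewrite lt_min; apply/andP; split; apply: divr_gt0.
- by rewrite ge_min lexx.
move=> Sigma a b [uS pS a0 nS oS] sS.
have [A [A0 hA]] := value_bound a b.
pose K : R := 2 ^+ e + k%:R * (4 + 2 * A%:R + 2 ^+ e).
have K0 : 0 <= K.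
  by rewrite /K addr_ge0 ?exprn_ge0 // mulr_ge0 // !addr_ge0 ?exprn_ge0 // mulr_ge0.
have half0 : 0 < 1 / 2 :> R by rewrite divr_gt0.
(* [K] collects the coefficients of sqrt x in the errors. T1 makes K sqrt x small against x / (ln
   z)^k, and T2 makes the 1/z of the square divisors small against (ln z)^-k. *)
have [T1 [T1_1 hT1]] := exp_dominates_pow k (K * 16 / c2) half0.
have [T2 [_ hT2]] := exp_dominates_pow k (16 * k%:R / c2) ltr01.
exists (Num.max 2 (exp (Num.max T1 T2))); split; first by rewrite le_max lexx.
move=> x z; rewrite ge_max => /andP[z2 zT] zx.
have z0 : 0 < z by apply: lt_le_trans z2.
set u := ln z; set t := ln x in zx *.
have zE : exp u = z := expK_ln z0.
have uT : Num.max T1 T2 <= u.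
  have := ler_ln (exp_gt0 _) zT; rewrite (_ : ln (exp _) = Num.max T1 T2) //; exact: ln_exp.
move: uT; rewrite ge_max => /andP[uT1 uT2].
have u1 : 1 <= u by apply: le_trans uT1.
have u0 : 0 < u by apply: lt_le_trans u1.
have ut : u <= eta * t.
  have := ler_ln z0 zx; rewrite (_ : ln (exp _) = eta * t) //; exact: ln_exp.
have t0 : 0 < t by rewrite -(pmulr_rgt0 _ eta_gt0); apply: lt_le_trans ut.
have eta_half : eta <= 1 / 2 := le_trans eta_le0 eta0_le.
have ut2 : u <= t.
  apply: le_trans ut _; rewrite ger_pMl //; apply: le_trans eta_half _.
  by rewrite ler_pdivrMr // mul1r ler1n.
have x0 : 0 < x := ln_gt0_pos t0.
have xE : exp t = x := expK_ln x0.
have x2 : 2 <= x.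
  by apply: le_trans z2 _; rewrite -zE -xE; apply: ler_exp.
have [Nx xN] := nfloor_bounds (ltW x0).
set N := nfloor x in Nx xN.
have N_half : x / 2 <= N%:R by move: xN; rewrite -natr1 => xN; lra.
have N0 : (0 < N)%N by rewrite -(ltr_nat R); apply: lt_le_trans N_half; rewrite divr_gt0.
have [M hM] := nat_ceil_exists z.
pose y := exp (eta0 * t).
have [M' hM'] := nat_ceil_exists y.
pose X2 := exp (1 / 2 * t).
have [Mx hMx] := nat_ceil_exists X2.
have X2_gt0 : 0 < X2 := exp_gt0 _.
have X2E : X2 * X2 = x.
  by rewrite -xE /X2 -expD; congr exp; field.
have exp_ge1 v : 0 <= v -> 1 <= exp v.
  by move=> v0; apply: le_trans (expR_ge1D v); rewrite lerDl.
have X2_1 : 1 <= X2 by apply: exp_ge1; rewrite mulr_ge0 // ltW.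
have y1 : 1 <= y by apply: exp_ge1; rewrite mulr_ge0 // ltW.
have yX2 : y <= X2 by apply: ler_exp; rewrite ler_pM2r.
have zy : z <= y.
  by rewrite -zE; apply: ler_exp; apply: le_trans ut _; rewrite ler_pM2r.
have z_1 : 1 <= z by apply: le_trans z2; rewrite ler1n.
have [zM Mz] := nat_ceil_bounds hM z_1.
have [yM My] := nat_ceil_bounds hM' y1.
have [XM MX] := nat_ceil_bounds hMx X2_1.
have MM' : (M <= M')%N := nat_ceil_mono hM hM' zy.
have M2 : (2 <= M)%N by rewrite -(ler_nat R); apply: le_trans zM.
have val i n : (n <= N)%N -> (`|Lform a b i n%:Z| < (A * Mx) ^ 2)%N.
  move=> nN; apply: leq_trans (hA i n N N0 nN) _.
  rewrite expnMn leq_mul //; first by rewrite leq_pmulr.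
  rewrite -(ler_nat R) natrX; apply: le_trans Nx _; rewrite -X2E -expr2.
  by rewrite lerXn2r ?nnegrE // ltW.
have := Omega1_lower exponent_e uS pS a0 nS oS M2 MM' hM val.
rewrite -/N sS -/D; apply: le_trans.
pose w := (u ^+ k)^-1.
have uk0 : 0 < u ^+ k by rewrite exprn_gt0.
have w0 : 0 < w by rewrite invr_gt0.
have M_gt0 : 0 < M%:R :> R by apply: lt_le_trans zM.
have ln_M : u <= ln M%:R by apply: ler_ln.
have ln_M2 : ln M%:R <= 2 * u.
  apply: le_trans (ler_ln M_gt0 Mz) _; rewrite lnM //.
  by rewrite -/u; have : ln 2 <= u :> R; [exact: ler_ln|move=> h; lra].
have ln_M' : eta0 * t <= ln M'%:R.
  by rewrite -[X in X <= _](ln_exp (eta0 * t)%R); apply: ler_ln => //; exact: exp_gt0.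
have h1 : c2 * w <= \prod_(p <- primes_outside Sigma M) (1 - k%:R / p%:R).
  apply: le_trans (hc Sigma M M2 _); last first.
    by move=> p; rewrite mem_primes_outside => /and3P[pp pS' _]; have [] := oS p pp pS'.
  have lM0 : 0 < ln M%:R :> R by apply: lt_le_trans ln_M.
  rewrite /c2 /w -mulrA -invfM -exprMn ler_wpM2l ?(ltW c0) //.
  rewrite lef_pV2 ?posrE ?exprn_gt0 ?mulr_gt0 //.
  by rewrite lerXn2r ?nnegrE ?mulr_ge0 // ltW.
have h2 : k%:R * (2 * N%:R * ((D / ln M%:R) ^+ k.-1 * (D / ln M'%:R))) <= N%:R * (c2 / 8) * w.
  have lM0 : 0 < ln M%:R :> R by apply: lt_le_trans ln_M.
  have et0 : 0 < eta0 * t by apply: mulr_gt0.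
  have a1 : (D / ln M%:R) ^+ k.-1 <= (D / u) ^+ k.-1.
    rewrite lerXn2r ?nnegrE ?divr_ge0 ?(ltW D0) ?(ltW lM0) ?(ltW u0) //.
    by rewrite ler_wpM2l ?(ltW D0) // lef_pV2.
  have a2 : D / ln M'%:R <= D / u * r.
    rewrite -mulrA ler_wpM2l ?(ltW D0) //.
    apply: (@le_trans _ _ (eta0 * t)^-1).
      by rewrite lef_pV2 ?posrE // (lt_le_trans et0).
    rewrite ler_pdivlMl // ler_pdivrMr //; apply: le_trans ut _.
    have -> : r * (eta0 * t) = eta0 * r * t by ring.
    by rewrite ler_pM2r.
  have a3 : (D / ln M%:R) ^+ k.-1 * (D / ln M'%:R) <= (D / u) ^+ k.-1 * (D / u * r).
    apply: ler_pM => //; first by rewrite exprn_ge0 // divr_ge0 // ltW.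
    by rewrite divr_ge0 ?(ltW D0) // (le_trans (ltW et0)).
  have a4 : (D / u) ^+ k.-1 * (D / u * r) = c2 / (16 * k%:R) * w.
    rewrite mulrA -exprSr prednK // /r /w exprMn exprVn.
    by field; rewrite !gt_eqF //= ?exprn_gt0 ?k0.
  have a5 : 0 <= k%:R * (2 * N%:R) :> R by rewrite !mulr_ge0.
  rewrite mulrA; apply: le_trans (ler_wpM2l a5 a3) _; rewrite a4 le_eqVlt; apply/orP; left.
  by apply/eqP; field; rewrite gt_eqF.
have h3 : M%:R ^+ e + k%:R * (2 * M'%:R + (A * Mx)%:R + M'%:R ^+ e) <= K * X2.
  have p1 : M'%:R ^+ e <= 2 ^+ e * X2.
    apply: (@le_trans _ _ ((2 * y) ^+ e)).
      by rewrite lerXn2r ?nnegrE // mulr_ge0 // (le_trans _ y1).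
    rewrite exprMn ler_wpM2l ?exprn_ge0 // /y /X2.
    have -> : 1 / 2 * t = \sum_(i < e) (eta0 * t).
      rewrite sumr_const card_ord -mulrnAl -mulr_natr /eta0; congr (_ * _).
      by field; rewrite gt_eqF.
    by rewrite exp_sum prodr_const card_ord.
  have p2 : M%:R ^+ e <= 2 ^+ e * X2.
    by apply: le_trans p1; rewrite lerXn2r ?nnegrE // ler_nat.
  have p3 : (A * Mx)%:R <= A%:R * (2 * X2) by rewrite natrM ler_wpM2l.
  have p4 : 2 * M'%:R + (A * Mx)%:R + M'%:R ^+ e <= (4 + 2 * A%:R + 2 ^+ e) * X2 by lra.
  have := ler_wpM2l (ltW k0) p4; rewrite /K; lra.
have h4 : k%:R * (2 * N%:R / M%:R) <= N%:R * (c2 / 8) * w.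
  have := hT2 u uT2; rewrite mul1r zE => /le_trans /(_ zM) q1.
  have q2 : 16 * k%:R / c2 * u ^+ k * c2 * w = 16 * k%:R.
    by rewrite /w; field; rewrite !gt_eqF.
  have q3 : 16 * k%:R <= M%:R * (c2 * w).
    by rewrite -q2 -mulrA ler_wpM2r // mulr_ge0 // ltW.
  rewrite [X in X <= _]mulrA ler_pdivrMr //.
  have : N%:R * (16 * k%:R) <= N%:R * (M%:R * (c2 * w)) by rewrite ler_wpM2l.
  lra.
have h5 : K * X2 <= x * (c2 / 16) * w.
  have := hT1 t (le_trans uT1 ut2); rewrite -/X2 => q1.
  have q2 : K * 16 / c2 * u ^+ k <= X2.
    apply: le_trans q1; apply: ler_wpM2l; last by rewrite lerXn2r ?nnegrE ?(ltW u0) ?(ltW t0).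
    by rewrite divr_ge0 ?(ltW c20) // mulr_ge0.
  have q3 : K = K * 16 / c2 * u ^+ k * (c2 / 16 * w).
    by rewrite /w; field; rewrite !gt_eqF.
  rewrite {1}q3 -X2E; have : 0 <= c2 / 16 * w * X2.
    by apply: mulr_ge0 (ltW X2_gt0); apply: mulr_ge0 (ltW w0); apply: divr_ge0 => //; exact: ltW.
  move=> /ler_wpM2r /(_ _ _ q2); lra.
have h6 : c1 * x * w <= c2 / 16 * x * w.
  by rewrite ler_wpM2r ?(ltW w0) // ler_wpM2r ?(ltW x0) // ge_min lexx orbT.
have h7 : x / 2 * (c2 / 8 * w) <= N%:R * (c2 / 8 * w).
  by rewrite ler_wpM2r //; apply: mulr_ge0 (ltW w0); apply: divr_ge0 => //; exact: ltW.
have h8 : N%:R * (c2 * w) <= N%:R * \prod_(p <- primes_outside Sigma M) (1 - k%:R / p%:R).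
  by rewrite ler_wpM2l.
move: h2 h3 h4 h8; rewrite -/w; set V := \prod_(_ <- _) _.
set P1 := _ ^+ k.-1 * _; set me := M%:R ^+ e; set me' := M'%:R ^+ e; set q := (A * Mx)%:R.
set fr := _ / M%:R; move=> h2 h3 h4 h8.
lra.
Qed.
End PartA.

(** * Prime factors in a thin set *)

(** In [2^m, 2^m.+1) there are at most delta pi(2^m.+1) elements, so by Chebyshev their reciprocals
    add up to at most 8 delta / m.+1. Pieces below M are empty and the others have m.+1 >= l, so a
    uniform bound per piece suffices: in the application m / l is at most 2 / eta. *)
Lemma reciprocal_sum_density (P : pred nat) (delta l : R) (M : nat) :
  0 <= delta -> 0 < l ->
  (forall n, (M <= n)%N -> (count_upto P n)%:R <= delta * (count_upto prime n)%:R) ->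
  (forall j : nat, (M < 2 ^ j.+1)%N -> l <= j.+1%:R) ->
  forall m G, uniq G -> (forall p, p \in G -> [&& P p, (M <= p)%N & (0 < p < 2 ^ m)%N]) ->
  \sum_(p <- G) p%:R^-1 <= m%:R * (8 * delta / l) :> R.
Proof.
move=> d0 l0 hP hl; elim=> [|m IH] G uG hG.
  rewrite mul0r; case: G hG {uG} => [|p G] hG; first by rewrite big_nil.
  by have /and4P[_ _] := hG p (mem_head _ _); rewrite expn0 ltnS leqn0 lt0n => /negPf->.
rewrite (bigID (fun p => p < 2 ^ m)%N) /= -natr1 mulrDl mul1r -big_filter.
rewrite -[X in _ + X]big_filter; apply: lerD.
  apply: IH; first by rewrite filter_uniq.
  by move=> p; rewrite mem_filter => /andP[-> /hG /and3P[-> -> /andP[-> _]]].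
set B := [seq _ <- _ | _].
have hB p : p \in B -> [/\ P p, (M <= p)%N, (0 < p)%N, (2 ^ m <= p)%N & (p < 2 ^ m.+1)%N].
  by rewrite mem_filter -leqNgt => /andP[h /hG /and3P[-> -> /andP[-> ->]]].
have uB : uniq B by rewrite filter_uniq.
have [B0|[p0 p0B]] : B = [::] \/ exists p0, p0 \in B.
  by case: (B) => [|p0 B']; [left|right; exists p0; rewrite mem_head].
  by rewrite B0 big_nil divr_ge0 ?mulr_ge0 // ltW.
have [_ Mp _ _ p0m] := hB _ p0B; have Mm := leq_ltn_trans Mp p0m.
have h2 : 0 < (2 ^ m)%:R :> R by rewrite ltr0n expn_gt0.
have m1 : 0 < m.+1%:R :> R by rewrite ltr0n.
apply: (@le_trans _ _ ((size B)%:R / (2 ^ m)%:R)).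
  have -> : (size B)%:R / (2 ^ m)%:R = \sum_(p <- B) ((2 ^ m)%:R^-1 : R).
    by rewrite big_const_seq count_predT iter_addr addr0 mulr_natl.
  rewrite big_seq [X in _ <= X]big_seq; apply: ler_sum => p /hB [_ _ p0' pm _].
  by rewrite lef_pV2 ?posrE ?ltr0n ?expn_gt0 // ler_nat.
have sB : (size B)%:R <= delta * (count_upto prime (2 ^ m.+1))%:R.
  apply: le_trans (hP _ (ltnW Mm)); rewrite ler_nat /count_upto -size_filter.
  apply: uniq_leq_size => // p /hB [Pp _ p1 _ p2]; rewrite mem_filter Pp mem_iota p1.
  by rewrite add1n ltnS ltnW.
have := prime_count_dyadic m.+1; rewrite -(ler_nat R) !natrM -/(count_upto prime _) => hc.
have hc' : (count_upto prime (2 ^ m.+1))%:R <= 8 * (2 ^ m)%:R / m.+1%:R :> R.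
  rewrite ler_pdivlMr // mulrC; apply: le_trans hc _.
  by rewrite expnS natrM mulrA -natrM.
rewrite ler_pdivrMr //; apply: le_trans sB _.
apply: le_trans (ler_wpM2l d0 hc') _.
have hm := hl m Mm.
have -> : 8 * delta / l * (2 ^ m)%:R = delta * (8 * (2 ^ m)%:R) * l^-1 by ring.
rewrite [X in X <= _]mulrA; apply: ler_wpM2l; first by rewrite !mulr_ge0.
by rewrite lef_pV2.
Qed.

Section BadSet.
Variables (k e : nat) (Sigma : seq nat) (a b : 'I_k -> int).
Hypothesis exponent_e : sieve_exponent k e.
Hypothesis adm : admissible Sigma a b.
Variables (P : pred nat) (x z : R) (M W H : nat).
Let N := nfloor x.
Hypothesis P_prime : forall p, P p -> prime p.
Hypothesis M_z : forall p : nat, (p < M)%N = (p%:R < z).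
Hypothesis W2 : (2 <= W)%N.
Hypothesis WM : (W <= M)%N.
Hypothesis value_lt : forall i n, (n <= N)%N -> (`|Lform a b i n%:Z| < H)%N.

Definition medium_primes := [seq p <- iota 1 H | [&& P p, p \notin Sigma, (M <= p)%N & (p * M < H)%N]].

(** The sifting stops at W, a smaller power of x than z: a class modulo p may have only about z
    members, and the errors W^e, summed over all p, must stay below the main term. W <= M also keeps
    the sifting primes different from p. *)
Let hit i p n := dvdL a b p i n && all (fun p => ~~ has (fun i => dvdL a b p i n) (enum 'I_k))
  (primes_outside Sigma W).

(* Compositeness supplies a second prime factor, which is at least z, so that the
   prime of P is at most H / z and the sieve can be applied in its residue class. *)
Lemma bad_hit n : (n <= N)%N -> in_Omega1 Sigma a b z n ->
  ~ (forall p, P p -> ~ (p%:Z %| Lprod a b n%:Z)%Z) ->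
  has (fun i => has (fun p => hit i p n) medium_primes) (enum 'I_k).
Proof.
case: adm => _ _ _ nS _ nN [/(in_OmegaP _ _ _ _ M_z) sn comp] hbad.
have ndvd p i : prime p -> dvdL a b p i n -> p \notin Sigma /\ (M <= p)%N.
  move=> pp pL; have pS : p \notin Sigma by apply: contraL pL; exact: nS.
  split=> //; rewrite leqNgt; apply/negP => pM.
  have /(allP sn) /hasP[] : p \in primes_outside Sigma M.
    by rewrite mem_primes_outside pp pS.
  by exists i; rewrite ?mem_enum.
apply: contra_notT hbad => hno p Pp; have pp := P_prime Pp.
rewrite dvdz_Lprod // => /hasP[i _ pL]; move/negP: hno; apply.
apply/hasP; exists i; first by rewrite mem_enum.
have [pS pM] := ndvd p i pp pL.
have [_ [L1 Lnp]] := comp i.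
have LH := value_lt i nN.
have [m mE] := dvdnP (pL : (p %| `|Lform a b i n%:Z|)%N).
have m1 : (1 < m)%N.
  case: m mE => [|[|m]] // mE; first by rewrite mE in L1.
  by rewrite mE mul1n pp in Lnp.
have Mm : (M <= m)%N.
  have [|_ h] := ndvd (pdiv m) i (pdiv_prime m1).
    by rewrite /dvdL dvdzE mE /= dvdn_mulr // pdiv_dvd.
  by apply: leq_trans h _; apply: dvdn_leq; rewrite ?pdiv_dvd // ltnW.
have pH : (p * M < H)%N.
  by apply: leq_ltn_trans LH; rewrite mE mulnC leq_mul2r Mm orbT.
apply/hasP; exists p.
  rewrite mem_filter Pp pS pM pH mem_iota prime_gt0 //= add1n ltnS.
  apply: leq_trans (ltnW pH); rewrite leq_pmulr //.
  by apply: leq_trans WM; exact: ltnW.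
rewrite /hit pL /=; apply/allP => q; rewrite mem_primes_outside => /and3P[pq qS qW].
by apply: (allP sn); rewrite mem_primes_outside pq qS (leq_trans qW).
Qed.

Lemma count_bad_le :
  (count (fun n => ~~ pb (forall p, P p -> ~ (p%:Z %| Lprod a b n%:Z)%Z)) (Omega1 Sigma a b x z))%:R
  <= k%:R * (2 * N%:R * (2 ^+ size Sigma / ln W%:R) ^+ k * (\sum_(p <- medium_primes) p%:R^-1)
             + (size medium_primes)%:R * W%:R ^+ e) :> R.
Proof.
have [uS pS a0 nS oS] := adm.
apply: (@le_trans _ _ (\sum_(i <- enum 'I_k) \sum_(p <- medium_primes) count (hit i p) (iota 1 N))%N%:R).
  rewrite ler_nat /Omega1 count_filter.
  apply: (@leq_trans (count (fun n => has (fun i => has (fun p => hit i p n) medium_primes) (enum 'I_k)) (iota 1 N))).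
    rewrite -!size_filter; apply: uniq_leq_size; first by rewrite filter_uniq ?iota_uniq.
    move=> n; rewrite !mem_filter => /andP[/andP[/pbP hb /pbP h1] nN]; rewrite nN andbT.
    by apply: bad_hit => //; move: nN; rewrite mem_iota add1n ltnS => /andP[].
  apply: leq_trans (count_has_le (fun n i => has (fun p => hit i p n) medium_primes) _ _) _.
  by apply: leq_sum => i _; apply: (count_has_le (fun n p => hit i p n)).
rewrite natr_sum; set B := (X in _ <= k%:R * X).
have -> : k%:R * B = \sum_(i <- enum 'I_k) B.
  by rewrite big_const_seq count_predT size_enum_ord iter_addr addr0 mulr_natl.
apply: ler_sum => i _; rewrite natr_sum /B mulr_sumr.
have -> : (size medium_primes)%:R * W%:R ^+ e = \sum_(p <- medium_primes) (W%:R ^+ e : R).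
  by rewrite big_const_seq count_predT iter_addr addr0 mulr_natl.
rewrite -big_split /= big_seq [X in _ <= X]big_seq; apply: ler_sum => p.
rewrite mem_filter => /andP[/and4P[Pp pSig pM pH] _]; have pp := P_prime Pp.
have p0 := prime_gt0 pp.
have cop : coprimez p (a i) by rewrite coprimezE coprime_sym coprime_sym (coprime_outside oS).
have [r _ hr] := dvdL_root b p0 cop.
have copW q : q \in primes_outside Sigma W -> coprime q p.
  rewrite mem_primes_outside => /and3P[pq _ qW]; rewrite prime_coprime // dvdn_prime2 //.
  by rewrite neq_ltn (leq_trans qW) // (leq_trans WM).
have := sifted_upper_class exponent_e uS oS N r W2 p0 copW.
rewrite (mulrAC _ _ p%:R^-1) -[2 * N%:R / p%:R]mulrA; apply: le_trans.
rewrite ler_nat; apply: sub_count => n /=; rewrite /hit hr => /andP[/eqP nr ->].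
by rewrite andbT -nr modn_mod.
Qed.

End BadSet.

(** * Choice of eps, and the elements of Omega_1 with a prime factor in P *)

Section PartB.
Variables (k s e : nat) (eta c1 : R).
Hypothesis k_gt0 : (0 < k)%N.
Hypothesis e_gt0 : (0 < e)%N.
Hypothesis exponent_e : sieve_exponent k e.
Hypothesis eta_gt0 : 0 < eta.
Hypothesis eta_le : eta <= 1 / 2.
Hypothesis c1_gt0 : 0 < c1.

Lemma bad_upper_bound : exists eps : R, [/\ 0 < eps, eps <= 1 / 2 &
  forall Sigma (a b : 'I_k -> int), admissible Sigma a b -> size Sigma = s ->
  forall P : pred nat, (forall p, P p -> prime p) ->
  (exists n0, forall n, (n0 <= n)%N ->
     (count_upto P n)%:R <= 2 * eps * (count_upto prime n)%:R) ->
  exists x0 : R, 2 <= x0 /\ forall x : R, x0 <= x ->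
    (count (fun n => ~~ pb (forall p, P p -> ~ (p%:Z %| Lprod a b n%:Z)%Z))
       (Omega1 Sigma a b x (exp (eta * ln x))))%:R
    <= c1 / 2 * x / (eta * ln x) ^+ k].
Proof.
have k0 : 0 < k%:R :> R by rewrite ltr0n.
have e0 : 0 < e%:R :> R by rewrite ltr0n.
pose D : R := 2 ^+ s; have D0 : 0 < D by rewrite exprn_gt0.
(* The level w = x^eta' satisfies w^e = x^(eta/2), while there are at most A x^(1 - eta) primes p;
   the total error is then of order x^(1 - eta/2). *)
pose eta' : R := eta / (2 * e%:R).
have e2 : 0 < 2 * e%:R :> R by apply: mulr_gt0.
have eta'_gt0 : 0 < eta' by apply: divr_gt0.
have eta'_le : eta' <= eta.
  by rewrite ler_pdivrMr // ler_pMr // -natrM ler1n muln_gt0.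
have D'k : 0 < (D / eta') ^+ k by rewrite exprn_gt0 // divr_gt0.
(* Solves 2k (D / eta')^k (32 eps0 / eta) = c1 / 4, where 32 eps / eta bounds the sum of 1/p. The
   error gets another c1/4, for c1/2 in all. *)
pose eps0 : R := c1 * eta / (256 * k%:R * (D / eta') ^+ k).
have den0 : 0 < 256 * k%:R * (D / eta') ^+ k by apply: mulr_gt0 D'k; apply: mulr_gt0.
have eps0_gt0 : 0 < eps0 by apply: divr_gt0 den0; apply: mulr_gt0.
pose eps : R := Num.min (1 / 2) eps0.
have eps_gt0 : 0 < eps by rewrite lt_min eps0_gt0 divr_gt0.
have eps_le : eps <= eps0 by rewrite ge_min lexx orbT.
exists eps; split=> //; first by rewrite ge_min lexx.
move=> Sigma a b adm sS P P_prime [n0 hn0].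
have [A [A0 hA]] := value_bound a b.
have A0' : 0 < A%:R :> R by rewrite ltr0n.
have half_eta : 0 < eta / 2 by apply: divr_gt0.
(* T1 absorbs the sieve errors. T2 keeps the number of dyadic pieces up to A N at most 2 ln x / ln
   2. T3 gives n0 <= z, so that the density estimate holds from M on. *)
have [T1 [T1_1 hT1]] := exp_dominates_pow k (4 * k%:R * A%:R * 2 ^+ e / c1) half_eta.
pose T2 : R := ln A%:R + 2 * ln 2.
pose T3 : R := n0%:R / eta.
pose T := Num.max T1 (Num.max T2 T3).
exists (Num.max 2 (exp T)); split; first by rewrite le_max lexx.
move=> x; rewrite ge_max => /andP[x2 xT].
have x0 : 0 < x by apply: lt_le_trans x2.
set t := ln x; have xE : exp t = x := expK_ln x0.
have : T <= t by have := ler_ln (exp_gt0 _) xT; rewrite (_ : ln (exp T) = T) //; exact: ln_exp.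
rewrite /T !ge_max => /and3P[tT1 tT2 tT3].
have t1 : 1 <= t by apply: le_trans tT1.
have t0 : 0 < t by apply: lt_le_trans t1.
have [Nx xN] := nfloor_bounds (ltW x0); set N := nfloor x in Nx xN.
have N0 : (0 < N)%N.
  rewrite -ltnS -(ltr_nat R); apply: le_lt_trans xN; apply: le_trans x2.
  by rewrite ler1n.
set z := exp (eta * t).
have [M hM] := nat_ceil_exists z.
pose w := exp (eta' * t).
have [W hW] := nat_ceil_exists w.
have et0 : 0 < eta * t by apply: mulr_gt0.
have et'0 : 0 < eta' * t by apply: mulr_gt0.
have exp_gt1 v : 0 < v -> 1 < exp v.
  by move=> v0; apply: lt_le_trans (expR_ge1D v); rewrite ltrDl.
have z1 : 1 <= z by apply/ltW/exp_gt1.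
have w1 : 1 < w by apply: exp_gt1.
have [zM Mz] := nat_ceil_bounds hM z1.
have [wW Ww] := nat_ceil_bounds hW (ltW w1).
have W2 : (2 <= W)%N by rewrite hW.
have WM : (W <= M)%N by apply: (nat_ceil_mono hW hM); apply: ler_exp; rewrite ler_pM2r.
have val i n : (n <= N)%N -> (`|Lform a b i n%:Z| < A * N)%N by apply: hA.
have := count_bad_le exponent_e adm P_prime hM W2 WM val; rewrite sS -/D.
rewrite -/N; set G := medium_primes _ _ _ _ => hcount.
apply: le_trans hcount _.
have uG : uniq G by rewrite filter_uniq ?iota_uniq.
have M0 : 0 < M%:R :> R by apply: lt_le_trans zM; apply: exp_gt0.
have AN0 : (0 < A * N)%N by rewrite muln_gt0 A0.
have ln2_gt0 : 0 < ln 2 :> R by apply: ln_gt0; rewrite ltr1n.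
have sizeG : (size G)%:R <= A%:R * N%:R / z.
  have : (size G <= (A * N) %/ M)%N.
    rewrite -[X in (_ <= X)%N](size_iota 1); apply: uniq_leq_size => // p.
    rewrite mem_filter mem_iota => /andP[/and4P[_ _ pM pH] /andP[p0 _]].
    have M_gt0 : (0 < M)%N by rewrite -(ltr_nat R).
    rewrite mem_iota p0 add1n ltnS (leq_divRL _ _ M_gt0); exact: ltnW pH.
  rewrite -(ler_nat R) => /le_trans; apply.
  rewrite ler_pdivlMr ?exp_gt0 //; apply: le_trans (_ : _ <= ((A * N) %/ M)%:R * M%:R) _.
    by rewrite ler_wpM2l.
  by rewrite -!natrM ler_nat leq_divM.
have powW : W%:R ^+ e <= 2 ^+ e * exp (eta / 2 * t).
  apply: (@le_trans _ _ ((2 * w) ^+ e)).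
    by rewrite lerXn2r ?nnegrE // mulr_ge0 // (le_trans _ (ltW w1)).
  rewrite exprMn ler_wpM2l ?exprn_ge0 // /w.
  have -> : eta / 2 * t = \sum_(i < e) (eta' * t).
    rewrite sumr_const card_ord -mulrnAl -mulr_natr /eta'; congr (_ * _).
    by field; rewrite gt_eqF.
  by rewrite exp_sum prodr_const card_ord.
have sumG : \sum_(p <- G) p%:R^-1 <= 32 * eps / eta.
  pose l := eta * t / ln 2.
  have l0 : 0 < l by apply: divr_gt0.
  pose m := (trunc_log 2 (A * N)).+1.
  have d0 : 0 <= 2 * eps by rewrite mulr_ge0 // ltW.
  have hP n : (M <= n)%N -> (count_upto P n)%:R <= 2 * eps * (count_upto prime n)%:R.
    move=> Mn; apply: hn0; apply: leq_trans Mn; rewrite -(ler_nat R).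
    apply: le_trans zM; apply: le_trans (expR_ge1D _).
    by move: tT3; rewrite /T3 ler_pdivrMr // mulrC => h; lra.
  have hl j : (M < 2 ^ j.+1)%N -> l <= j.+1%:R.
    move=> Mj; rewrite ler_pdivrMr // -lnXn //.
    have : exp (eta * t) <= 2 ^+ j.+1.
      by apply: le_trans zM _; rewrite -natrX ler_nat ltnW.
    by move=> /(ler_ln (exp_gt0 _)); rewrite (_ : ln (exp _) = eta * t) //; exact: ln_exp.
  have hG p : p \in G -> [&& P p, (M <= p)%N & (0 < p < 2 ^ m)%N].
    rewrite mem_filter mem_iota => /andP[/and4P[-> _ -> _] /andP[-> pH]] /=.
    move: pH; rewrite add1n ltnS => pH.
    by apply: leq_ltn_trans pH _; apply: trunc_log_ltn.
  have := reciprocal_sum_density d0 l0 hP hl uG hG; move/le_trans; apply.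
  have hm : m%:R * ln 2 <= 2 * t.
    have : (trunc_log 2 (A * N))%:R * ln 2 <= ln A%:R + t.
      rewrite -lnXn // /t -lnM //; apply: ler_ln; first by rewrite exprn_gt0.
      apply: (@le_trans _ _ (A * N)%:R); first by rewrite -natrX ler_nat trunc_logP.
      by rewrite natrM ler_pM2l.
    by rewrite /m -natr1 mulrDl mul1r; move: tT2; rewrite /T2; lra.
  have -> : m%:R * (8 * (2 * eps) / l) = (m%:R * ln 2) * (16 * eps / (eta * t)).
    by rewrite /l; field; rewrite !gt_eqF.
  have -> : 32 * eps / eta = (2 * t) * (16 * eps / (eta * t)).
    by field; rewrite !gt_eqF.
  by rewrite ler_wpM2r // divr_ge0 ?(ltW et0) // mulr_ge0 // ltW.
pose v := (t ^+ k)^-1.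
have tk0 : 0 < t ^+ k by rewrite exprn_gt0.
have v0 : 0 < v by rewrite invr_gt0.
have ln_W : eta' * t <= ln W%:R.
  by rewrite -[X in X <= _](ln_exp (eta' * t)%R); apply: ler_ln => //; exact: exp_gt0.
have lW0 : 0 < ln W%:R :> R by apply: lt_le_trans ln_W.
have hD : (D / ln W%:R) ^+ k <= (D / eta') ^+ k * v.
  have -> : (D / eta') ^+ k * v = (D / (eta' * t)) ^+ k.
    by rewrite /v -exprVn -exprMn -mulrA -invfM.
  rewrite lerXn2r ?nnegrE ?divr_ge0 ?(ltW D0) ?(ltW lW0) ?(ltW et'0) //.
  by rewrite ler_wpM2l ?(ltW D0) // lef_pV2.
have S0 : 0 <= \sum_(p <- G) p%:R^-1 :> R by apply: sumr_ge0 => p _; rewrite invr_ge0.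
have part1 : k%:R * (2 * N%:R * (D / ln W%:R) ^+ k * (\sum_(p <- G) p%:R^-1)) <= c1 / 4 * x * v.
  have a1 : (D / ln W%:R) ^+ k * (\sum_(p <- G) p%:R^-1) <= (D / eta') ^+ k * v * (32 * eps0 / eta).
    apply: ler_pM => //; first by rewrite exprn_ge0 // divr_ge0 // ltW.
    apply: le_trans sumG _; rewrite ler_pM2r ?invr_gt0 // ler_pM2l //.
  have a2 : (D / eta') ^+ k * v * (32 * eps0 / eta) * (8 * k%:R) = c1 * v.
    rewrite /eps0; move: D'k; set Dk := (D / eta') ^+ k => D'k.
    by field; rewrite !gt_eqF.
  have a3 : 0 <= k%:R * (2 * N%:R) :> R by rewrite !mulr_ge0.
  rewrite -[2 * N%:R * _ * _]mulrA [X in X <= _]mulrA.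
  apply: le_trans (ler_wpM2l a3 a1) _.
  have -> : k%:R * (2 * N%:R) * ((D / eta') ^+ k * v * (32 * eps0 / eta)) =
     N%:R / 4 * ((D / eta') ^+ k * v * (32 * eps0 / eta) * (8 * k%:R)).
    by move: ((D / eta') ^+ k) => Dk; field; rewrite gt_eqF.
  rewrite a2; have : N%:R * (c1 * v) <= x * (c1 * v) by rewrite ler_wpM2r // mulr_ge0 // ltW.
  lra.
pose X2 := exp (eta / 2 * t); have X20 : 0 < X2 := exp_gt0 _.
have zX : z = X2 * X2 by rewrite /z /X2 -expD; congr exp; field.
have part2 : k%:R * ((size G)%:R * W%:R ^+ e) <= c1 / 4 * x * v.
  have a1 : (size G)%:R * W%:R ^+ e <= (A%:R * N%:R / z) * (2 ^+ e * X2).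
    by apply: ler_pM => //; rewrite exprn_ge0.
  apply: le_trans (ler_wpM2l (ltW k0) a1) _.
  have -> : k%:R * (A%:R * N%:R / z * (2 ^+ e * X2)) = N%:R * (k%:R * A%:R * 2 ^+ e / X2).
    by rewrite zX; field; rewrite gt_eqF.
  have a2 : k%:R * A%:R * 2 ^+ e / X2 <= c1 / 4 * v.
    have cv0 : 0 <= c1 / 4 * v.
      by apply: mulr_ge0 (ltW v0); apply: divr_ge0 => //; exact: ltW.
    rewrite ler_pdivrMr //; apply: le_trans (ler_wpM2l cv0 (hT1 t tT1)).
    rewrite le_eqVlt /v; apply/orP; left; apply/eqP.
    by field; rewrite !gt_eqF.
  apply: le_trans (ler_wpM2l (ler0n _ _) a2) _.
  have : N%:R * (c1 / 4 * v) <= x * (c1 / 4 * v).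
    by rewrite ler_wpM2r // mulr_ge0 ?(ltW v0) // divr_ge0 // ltW.
  lra.
have hv : c1 / 2 * x * v <= c1 / 2 * x / (eta * t) ^+ k.
  apply: ler_wpM2l; first by apply: mulr_ge0 (ltW x0); apply: divr_ge0 => //; exact: ltW.
  rewrite /v lef_pV2 ?posrE ?exprn_gt0 // lerXn2r ?nnegrE ?(ltW et0) ?(ltW t0) //.
  by rewrite ger_pMl //; apply: le_trans eta_le _; rewrite ler_pdivrMr // mul1r ler1n.
by apply: le_trans hv; rewrite mulrDr; lra.
Qed.
End PartB.

(** * From the hypotheses as stated to the sieve results *)

Lemma eventually_le_of_density (P : pred nat) (eps : R) : 0 < eps ->
  Rbar_le (rel_upper_density P) (Rbar.Finite eps) ->
  exists n0, forall n, (n0 <= n)%N ->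
    (count_upto P n)%:R <= 2 * eps * (count_upto prime n)%:R :> R.
Proof.
move=> eps0; rewrite /rel_upper_density; set u := fun n => _.
have eps0' : Rlt 0 eps by apply/RltP.
suff ev : Rbar_le (LimSup_seq u) (Rbar.Finite eps) ->
    exists n0, forall n, (n0 <= n)%N -> Rle (u n) (Rplus eps eps).
  (* From n = 2 on there is a prime up to n, so the quotient is a genuine one and can be cleared. *)
  move=> /ev [n0 hn0]; exists (maxn n0 2) => n; rewrite geq_max => /andP[n0n n2].
  have : u n <= 2 * eps by rewrite mulr_natl mulr2n; apply/RleP; exact: hn0.
  rewrite /u RdivE !INRE ler_pdivrMr // ltr0n -has_count.
  by apply/hasP; exists 2; rewrite // mem_iota.
rewrite /LimSup_seq; case: (ex_LimSup_seq u) => -[l| |] //=.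
- move=> /(_ (mkposreal _ eps0')) [_ [n0 hn0]] l_eps; exists n0 => n /ssrnat.leP /hn0 /= h.
  by Lra.lra.
- move=> /(_ eps) [n0 hn0] _; exists n0 => n /ssrnat.leP /hn0 h.
  by rewrite -R0E in eps0'; Lra.lra.
Qed.

Lemma admissible_of_hypotheses (k : nat) (Sigma : seq nat) (a b : 'I_k -> int) :
  uniq Sigma -> all prime Sigma ->
  (forall i, a i != 0) -> (forall i, gcdz (a i) (b i) = 1%N) ->
  sigma_unit Sigma ((k.*2)`!%:Z * (\prod_(i < k) a i) *
     \prod_(i < k) \prod_(j < k | (i < j)%N) (a i * b j - a j * b i)) ->
  (forall i p, p \in Sigma -> (p%:Z %| a i)%Z) ->
  admissible Sigma a b.
Proof.
move=> uS pS a0 cop unit_ab Sa; split=> //.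
- by move=> i p n; apply: Sigma_not_dvdL.
- by move=> p; apply: separated_outside.
Qed.

Local Open Scope R_scope.

Theorem theorem4p1 (k s : nat) (hk : (0 < k)%N) :
  exists eta c1 eps : R,
    0 < eta <= 1/2 /\ 0 < c1 <= 1/2 /\ 0 < eps <= 1/2 /\
    forall (Sigma : seq nat), uniq Sigma -> all prime Sigma -> size Sigma = s ->
    forall (a b : 'I_k -> int),
      (forall i, (a i != 0)%R) ->
      (forall i, gcdz (a i) (b i) = 1%N) ->
      (forall i j : 'I_k, (i < j)%N -> (a i * b j - a j * b i != 0)%R) ->
      sigma_unit Sigma
        (((k.*2)`!)%:Z * (\prod_(i < k) a i) *
           \prod_(i < k) \prod_(j < k | (i < j)%N) (a i * b j - a j * b i))%R ->
      (forall i, forall p, p \in Sigma -> (p%:Z %| a i)%Z) ->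
      (* (a) *)
      (exists z1 : R, 2 <= z1 /\
         forall x z : R, z1 <= z -> z <= Rpower x eta ->
           c1 * x / (ln z) ^ k <= INR (size (Omega1 Sigma a b x z))) /\
      (* (b) *)
      (forall P : pred nat, (forall p, P p -> prime p) ->
         Rbar_le (rel_upper_density P) (Rbar.Finite eps) ->
         exists x0 : R, 2 <= x0 /\
           forall x : R, x0 <= x ->
             (size (Omega1 Sigma a b x (Rpower x eta))
               <= 2 * size [seq n <- Omega1 Sigma a b x (Rpower x eta) |
                             pb (forall p, P p -> ~ (p%:Z %| Lprod a b n%:Z)%Z)])%N).
Proof.
have [e [e0 he]] := sieve_linear_forms k.
have [eta [c1 [eta0 eta_le c10 c1_le hA]]] := Omega1_lower_bound s hk e0 he.
have [eps [eps0 eps_le hB]] := bad_upper_bound s hk e0 he eta0 eta_le c10.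
have two : (2%:R)%R = 2 :> R by rewrite -INRE /=; Lra.lra.
have half : (1 / 2%:R)%R = 1 / 2 :> R by rewrite two RdivE R1E.
rewrite half in eta_le c1_le eps_le.
exists eta, c1, eps.
split; first by split; [exact/RltP|exact/RleP].
split; first by split; [exact/RltP|exact/RleP].
split; first by split; [exact/RltP|exact/RleP].
move=> Sigma uS pS sS a b a0 cop det unit_ab Sa.
have adm : admissible Sigma a b by apply: admissible_of_hypotheses.
have [z1 [z1_2 hz1]] := hA Sigma a b adm sS.
split.
  exists z1; split; first by apply/RleP; rewrite -two.
  move=> x z /RleP z1z /RleP zx; apply/RleP; rewrite INRE RdivE RmultE RpowE.
  exact: hz1.
move=> P P_prime /(eventually_le_of_density eps0) dens.
have [x0 [x0_2 hx0]] := hB Sigma a b adm sS P P_prime dens.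
(* The second bound gives x^eta >= z1, so that part (a) applies with z = x^eta. *)
exists (Rmax x0 (exp (ln z1 / eta))); split.
  by apply: Rle_trans (Rmax_l _ _); apply/RleP; rewrite -two.
move=> x hx.
have /RleP x0x : x0 <= x := Rle_trans _ _ _ (Rmax_l _ _) hx.
have /RleP z1x : exp (ln z1 / eta) <= x := Rle_trans _ _ _ (Rmax_r _ _) hx.
have z10 : (0 < z1)%R by apply: lt_le_trans z1_2; rewrite ltr0n.
have z1_le : (z1 <= exp (eta * ln x))%R.
  rewrite -[X in (X <= _)%R](expK_ln z10); apply: ler_exp.
  rewrite -ler_pdivrMl //; have := ler_ln (exp_gt0 _) z1x.
  by rewrite ln_exp mulrC.
have lower := hz1 x _ z1_le (lexx _); have upper := hx0 x x0x.
rewrite ln_exp in lower; rewrite /Rpower.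
set Om := Omega1 _ _ _ _ _ in lower upper *; set good := fun n => pb _.
have split_count : (size Om = count good Om + count (predC good) Om)%N by rewrite count_predC.
(* The bad elements number at most half of the lower bound of part (a) for Omega_1 at z = x^eta,
   where ln z = eta ln x. *)
have : ((count (predC good) Om)%:R <= (size Om)%:R / 2%:R :> R)%R.
  apply: le_trans upper _.
  rewrite ler_pdivlMr ?ltr0n //; apply: le_trans lower; rewrite le_eqVlt; apply/orP; left.
  apply/eqP; set D := (_ ^+ k)%R.
  by lra.
rewrite ler_pdivlMr ?ltr0n // -natrM ler_nat size_filter.
by rewrite split_count muln2 mul2n -!addnn leq_add2r leq_add2l.
Qed.
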